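(* Let $G$ be an algebraic subgroup of $GL(n,\mathbb{R})$, with normalizer $\mathcal{N}(G)=\{g\in GL(n,\mathbb{R}) : g^{-1}Gg=G\}$, and let $M$ be an $n$-dimensional smooth manifold. Then any $\mathcal{N}(G)$-structure on $M$ can be given by the projectivization of an inhomogeneous tensor field $t=\sum_{i=1}^m t_i$, where each $t_i$ is a $0$-deformable tensor field on $M$ of type $(r_i,s_i)$.
   Context: For a Lie subgroup $K\subset GL(n,\mathbb{R})$, a $K$-structure on $M$ is a reduction $P\subset \mathcal{F}M$ of the linear frame bundle $\mathcal{F}M$ of $M$ to the group $K$. A tensor field of type $(r,s)$ is a section of $TM^{\otimes r}\otimes (T^*M)^{\otimes s}$. Such a tensor field $\sigma$ is $0$-deformable if for all $x,y\in M$ there is a linear isomorphism $T_xM\to T_yM$ whose induced action on tensors maps $\sigma(x)$ to $\sigma(y)$. The sum $t=\sum_i t_i$ is understood as a section of the direct sum of the tensor bundles of types $(r_i,s_i)$. The group $GL(n,\mathbb{R})$ acts on $W=\bigoplus_i (\mathbb{R}^n)^{\otimes r_i}\otimes((\mathbb{R}^n)^* )^{\otimes s_i}$ by the natural tensorial representation $\rho$. A linear frame $p$ at $x$ is viewed as an isomorphism $\mathbb{R}^n\to T_xM$, so that $t(x)$ has components $p^{-1}t(x)\in W$. A $K$-structure $P$ is given by the projectivization of $t$ if there is a nonzero $u\in W$ such that $K=\{g\in GL(n,\mathbb{R}) : \exists\lambda\ne0,\ \rho(g)u=\lambda u\}$, $t(x)$ is nonzero for every $x$, the class of the components of $t$ in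 $\mathbb{P}W$ lies in the $GL(n,\mathbb{R})$-orbit of $[u]$, and $P$ is the set of frames $p$ for which the components of $t$ with respect to $p$ are a nonzero multiple of $u$. *)

(* Defs.v *)
From HB Require Import structures.
From mathcomp Require Import all_boot all_order all_algebra.
From mathcomp Require Import ring.
From mathcomp Require mpoly.
From mathcomp Require Import all_classical all_reals all_analysis.

Set Implicit Arguments.
Unset Strict Implicit.
Unset Printing Implicit Defensive.

Import Order.TTheory GRing.Theory Num.Theory.
Import numFieldNormedType.Exports.

Local Open Scope classical_set_scope.
Local Open Scope ring_scope.

Section Smooth.
Variables (R : realType) (V W : normedModType R).

(* Meaningful for open [U]. *)
Fixpoint Ck (k : nat) (U : set V) (f : V -> W) : Prop :=
  match k with
  | 0 => forall x, U x -> {for x, continuous f}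
  | k'.+1 => (forall x, U x -> differentiable f x) /\
             (forall v, Ck k' U (fun x => 'd f x v))
  end.

Definition smooth (U : set V) (f : V -> W) : Prop := forall k, Ck k U f.

Lemma diff_comp_near (V' : normedModType R) (f : V -> V') (g : V' -> W)
    (h : V -> W) (x v : V) :
  differentiable f x -> differentiable g (f x) -> differentiable h x ->
  (\forall y \near x, g (f y) = h y) -> 'd g (f x) ('d f x v) = 'd h x v.
Proof.
move=> df dg dh gfh; rewrite -(deriveE _ dh) -(near_eq_derive _ gfh).
have dgf : differentiable (g \o f) x by exact: differentiable_comp.
transitivity ('d (g \o f) x v); first by rewrite (diff_comp df dg).
by rewrite -(deriveE _ dgf).
Qed.

End Smooth.

(* The atlas need not be maximal: it determines the smooth structure.  The
   values of [chart i] outside [chart_dom i], and of [ichart i] outside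
   [chart i @` chart_dom i], are irrelevant. *)
Record manifold (R : realType) (n : nat) := Manifold {
  points :> topologicalType;
  points_hausdorff : hausdorff_space points;
  points_second_countable : @second_countable points;
  chart_index : Type;
  chart_dom : chart_index -> set points;
  chart : chart_index -> points -> 'cV[R]_n;
  ichart : chart_index -> 'cV[R]_n -> points;
  chart_dom_open : forall i, open (chart_dom i);
  chart_dom_cover : forall x, exists i, chart_dom i x;
  chart_image_open : forall i, open (chart i @` chart_dom i);
  chartK : forall i x, chart_dom i x -> ichart i (chart i x) = x;
  chart_continuous : forall i x,
    chart_dom i x -> {for x, continuous (chart i)};
  ichart_continuous : forall i y,
    (chart i @` chart_dom i) y -> {for y, continuous (ichart i)};
  transition_smooth : forall i j,
    smooth (chart i @` (chart_dom i `&` chart_dom j)) (chart j \o ichart i)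
}.

Section Tangent.
Variables (R : realType) (n : nat) (M : manifold R n).
Implicit Types (i j k : chart_index M) (x : M).

Definition smooth_on (V : normedModType R) (U : set M) (f : M -> V) : Prop :=
  forall i, smooth (chart i @` (U `&` chart_dom i)) (f \o ichart i).

Definition dtransition i j x : 'cV[R]_n -> 'cV[R]_n :=
  'd (chart j \o ichart i) (chart i x).

(* A tangent vector at [x] is given by its coordinates in every chart around
   [x], which are related by the differentials of the transition maps; charts
   not containing [x] carry the dummy value 0. *)
Definition is_tangent x (v : chart_index M -> 'cV[R]_n) : Prop :=
  (forall i j, chart_dom i x -> chart_dom j x ->
     v j = dtransition i j x (v i)) /\
  (forall i, ~ chart_dom i x -> v i = 0).

Definition tangent_pred x : {pred chart_index M -> 'cV[R]_n} :=
  fun v => `[< is_tangent x v >].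

Lemma tangent_submod x : submod_closed (tangent_pred x).
Proof.
split=> [|a v w /asboolP[v1 v2] /asboolP[w1 w2]]; apply/asboolP; split.
- by move=> i j _ _; rewrite /dtransition linear0.
- by [].
- move=> i j xi xj; rewrite /dtransition linearP.
  by rewrite [LHS]/(a *: v j + w j) (v1 i j) // (w1 i j).
- move=> i xi; change (a *: v i + w i = 0 :> 'cV[R]_n); rewrite (v2 _ xi) (w2 _ xi). by rewrite scaler0 addr0.
Qed.

HB.instance Definition _ x := GRing.isSubmodClosed.Build R
  (chart_index M -> 'cV[R]_n) (tangent_pred x) (tangent_submod x).

Record tangent x := Tangent {
  tangent_val : chart_index M -> 'cV[R]_n;
  tangentP : tangent_val \in tangent_pred x }.

HB.instance Definition _ x := [isSub for @tangent_val x].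
HB.instance Definition _ x := [Choice of tangent x by <:].
HB.instance Definition _ x := [SubChoice_isSubLmodule of tangent x by <:].

Definition coord i x (v : tangent x) : 'cV[R]_n := tangent_val v i.

Lemma coord_is_linear i x : linear (@coord i x).
Proof. by []. Qed.

HB.instance Definition _ i x := GRing.isLinear.Build R (tangent x) 'cV[R]_n
  *:%R (@coord i x) (@coord_is_linear i x).

Definition dcoord i x (a : 'I_n) (v : tangent x) : R^o := coord i v a 0.

Lemma dcoord_is_linear i x a : linear (@dcoord i x a).
Proof. by move=> c v w; rewrite /dcoord linearP !mxE. Qed.

HB.instance Definition _ i x a := GRing.isLinear.Build R (tangent x) R^o
  *:%R (@dcoord i x a) (@dcoord_is_linear i x a).

Lemma transition_differentiable i j x : chart_dom i x -> chart_dom j x ->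
  differentiable (chart j \o ichart i) (chart i x).
Proof.
by move=> xi xj; have [+ _] := transition_smooth i j 1; apply; exists x.
Qed.

Lemma near_chart i (U : set M) x : chart_dom i x -> open U -> U x ->
  \forall y \near chart i x, U (ichart i y).
Proof.
move=> xi oU Ux; have ci := @ichart_continuous _ _ M i (chart i x).
have {}ci := ci (ex_intro2 _ _ x xi erefl).
by apply: ci; rewrite chartK //; apply: open_nbhs_nbhs.
Qed.

Lemma dtransition_cocycle i j k x (w : 'cV[R]_n) :
  chart_dom i x -> chart_dom j x -> chart_dom k x ->
  dtransition j k x (dtransition i j x w) = dtransition i k x w.
Proof.
move=> xi xj xk; rewrite /dtransition.
have dij := transition_differentiable xi xj.
have djk := transition_differentiable xj xk.
have dik := transition_differentiable xi xk.
have ex : (chart j \o ichart i) (chart i x) = chart j x by rewrite /= chartK.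
have gfh : \forall y \near chart i x,
    (chart k \o ichart j) ((chart j \o ichart i) y) = (chart k \o ichart i) y.
  have := near_chart xi (chart_dom_open j) xj.
  by apply: filterS => y yj /=; rewrite chartK.
move: dij djk dik ex gfh; move: (chart j \o ichart i) (chart k \o ichart j).
move: (chart k \o ichart i) (chart i x) (chart j x) => h y z f g.
by move=> df dg dh fyz; rewrite -fyz in dg *; apply: diff_comp_near.
Qed.

Lemma dtransition_id i x (w : 'cV[R]_n) :
  chart_dom i x -> dtransition i i x w = w.
Proof.
move=> xi; rewrite /dtransition -deriveE; last exact: transition_differentiable.
have img : nbhs (chart i x) (chart i @` chart_dom i).
  by apply: open_nbhs_nbhs; split; [exact: chart_image_open | exists x].
rewrite (@near_eq_derive _ _ _ _ id) ?derive_id //.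
by apply: filterS img => y [z zi <-] /=; rewrite chartK.
Qed.

Definition of_coord_val i x (w : 'cV[R]_n) j : 'cV[R]_n :=
  if `[< chart_dom i x /\ chart_dom j x >] then dtransition i j x w else 0.

Lemma of_coord_subproof i x w : of_coord_val i x w \in tangent_pred x.
Proof.
apply/asboolP; split=> [j k xj xk|j xj]; rewrite /of_coord_val; last first.
  by case: asboolP => // -[].
have [xi|xi] := pselect (chart_dom i x).
  by rewrite !asboolT // dtransition_cocycle.
by rewrite !asboolF ?[LHS]/0; [rewrite /dtransition linear0|case|case].
Qed.

(* The tangent vector at [x] with coordinates [w] in the chart [i] around
   [x]. *)
Definition of_coord i x (w : 'cV[R]_n) : tangent x :=
  Tangent (of_coord_subproof i x w).

Lemma of_coordK i x w : chart_dom i x -> coord i (of_coord i x w) = w.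
Proof.
by move=> xi; rewrite /coord /= /of_coord_val asboolT ?dtransition_id.
Qed.

Definition dchart i x (a : 'I_n) : tangent x := of_coord i x (delta_mx a 0).

End Tangent.

Section LinearMaps.
Variable R : realType.

Lemma linear_eqP (U V : lmodType R) (f g : {linear U -> V}) :
  f =1 g -> f = g.
Proof.
case: f => f [[f1] [f2]]; case: g => g [[g1] [g2]] /= /funext fg; subst g.
by rewrite (Prop_irrelevance f1 g1) (Prop_irrelevance f2 g2).
Qed.

Record lin_iso (U V : lmodType R) := LinIso {
  iso_fun :> {linear U -> V};
  iso_inv : {linear V -> U};
  iso_funK : cancel iso_fun iso_inv;
  iso_invK : cancel iso_inv iso_fun }.

End LinearMaps.

Section Tensors.
Variable R : realType.

Local Notation dual V := ({linear V -> R^o}).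

(* For [V] of finite dimension, the tensor product of [r] copies of [V] and [s]
   copies of its dual, as the space of forms in [r] covectors and [s] vectors
   that are linear in every argument. *)
Section TensorSpace.
Variables (V : lmodType R) (r s : nat).

Local Notation form := (('I_r -> dual V) -> ('I_s -> V) -> R^o).

Definition multilinear (T : form) : Prop :=
  (forall alpha v k (c : R) (a b : dual V),
     T [eta alpha with k |-> ((c \*: a) \+ b : dual V)] v =
     c * T [eta alpha with k |-> a] v + T [eta alpha with k |-> b] v) /\
  (forall alpha v k (c : R) (a b : V),
     T alpha [eta v with k |-> c *: a + b] =
     c * T alpha [eta v with k |-> a] + T alpha [eta v with k |-> b]).

Definition multilinear_pred : {pred form} := fun T => `[< multilinear T >].

Lemma multilinear_submod : submod_closed multilinear_pred.
Proof.
have addE e (T S : form) alpha v :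
  (e *: T + S) alpha v = e * T alpha v + S alpha v :> R by [].
split=> [|e T S /asboolP[T1 T2] /asboolP[S1 S2]]; apply/asboolP; split.
- by move=> alpha v k c a b; change (0 = c * 0 + 0 :> R); rewrite mulr0 addr0.
- by move=> alpha v k c a b; change (0 = c * 0 + 0 :> R); rewrite mulr0 addr0.
- by move=> alpha v k c a b; rewrite !addE T1 S1; ring.
- by move=> alpha v k c a b; rewrite !addE T2 S2; ring.
Qed.


HB.instance Definition _ := GRing.isSubmodClosed.Build R
  form multilinear_pred multilinear_submod.

Record tensor := Tensor {
  tensor_val :> form;
  tensorP : tensor_val \in multilinear_pred }.

HB.instance Definition _ := [isSub for tensor_val].
HB.instance Definition _ := [Choice of tensor by <:].
HB.instance Definition _ := [SubChoice_isSubLmodule of tensor by <:].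

End TensorSpace.

(* The action on tensors of a linear map [f] with inverse [f']. *)
Section Push.
Variables (U V : lmodType R) (r s : nat).
Variables (f : {linear U -> V}) (f' : {linear V -> U}) (T : tensor U r s).

Definition push_val (alpha : 'I_r -> dual V) (v : 'I_s -> V) : R^o :=
  T (fun k => alpha k \o f : dual U) (fun k => f' (v k)).

Lemma push_subproof : push_val \in @multilinear_pred V r s.
Proof.
have /asboolP[T1 T2] := tensorP T.
have pushE alpha v k (c : dual V) : push_val [eta alpha with k |-> c] v =
    T [eta (fun l => alpha l \o f : dual U) with k |-> c \o f : dual U]
      (fun l => f' (v l)).
  by congr (T _ _); apply/funext => l /=; case: eqP.
apply/asboolP; split=> alpha v k c a b.
  rewrite !pushE -T1; congr (T _ _); apply/funext => l /=.
  by case: eqP => // _; apply: linear_eqP.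
have push'E w : push_val alpha [eta v with k |-> w] =
    T (fun l => alpha l \o f : dual U)
      [eta (fun l => f' (v l)) with k |-> f' w].
  by congr (T _ _); apply/funext => l /=; case: eqP.
by rewrite !push'E -T2; congr (T _ _); apply/funext => l /=; rewrite linearP.
Qed.

Definition push : tensor V r s := Tensor push_subproof.

End Push.

End Tensors.

Definition tensor_map (R : realType) (U V : lmodType R) (r s : nat)
  (f : lin_iso U V) : tensor U r s -> tensor V r s := push f (iso_inv f).

(* The tensorial representation of [GL_n] on tensors over [R^n]; [g] is meant
   to be invertible. *)
Definition rho (R : realType) (n r s : nat) (g : 'M[R]_n) :
    tensor 'cV[R]_n r s -> tensor 'cV[R]_n r s :=
  push (mulmx g) (mulmx (invmx g)).

(* Subsets of [GL_n] are represented by sets of invertible matrices. *)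
Section MatrixGroups.
Variables (R : realType) (n : nat).
Implicit Types G K : set 'M[R]_n.

Definition subgroup G : Prop :=
  [/\ forall g, G g -> g \in unitmx, G 1%:M,
      forall g h, G g -> G h -> G (g *m h) & forall g, G g -> G (invmx g)].

Definition algebraic_subgroup G : Prop :=
  subgroup G /\
  exists S : set (mpoly.mpoly (n * n) R), forall g, g \in unitmx ->
    (G g <-> forall f, S f -> mpoly.meval (fun k => mxvec g 0 k) f = 0).

Definition normalizer G : set 'M[R]_n :=
  [set g | g \in unitmx /\ [set invmx g *m h *m g | h in G] = G].

End MatrixGroups.

Section Structures.
Variables (R : realType) (n : nat) (M : manifold R n).

Definition frame (x : M) := lin_iso 'cV[R]_n (tangent x).

(* [q] is the frame [p] acted upon by [g] on the right. *)
Definition frame_act (x : M) (p : frame x) (g : 'M[R]_n) (q : frame x) : Prop :=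
  forall w, q w = p (g *m w).

Definition smooth_frame_field (U : set M) (p : forall x, frame x) : Prop :=
  forall i (a : 'I_n),
    smooth_on (U `&` chart_dom i) (fun x => coord i (p x (delta_mx a 0))).

(* [P] is a reduction of the frame bundle to [K]: its fibres are [K]-orbits
   and it has smooth local sections. *)
Definition K_structure (K : set 'M[R]_n) (P : forall x : M, set (frame x)) :
    Prop :=
  (forall x (p q : frame x), P x p ->
     (P x q <-> exists2 g, K g & frame_act p g q)) /\
  (forall x, exists U (p : forall y, frame y),
     [/\ open U, U x, smooth_frame_field U p & forall y, U y -> P y (p y)]).

Record tensor_field (r s : nat) := TensorField {
  field_val :> forall x : M, tensor (tangent x) r s;
  field_smooth : forall i (a : 'I_r -> 'I_n) (b : 'I_s -> 'I_n),
    smooth_on (V := R^o) (chart_dom i)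
      (fun x => field_val x (fun k => dcoord i (a k) : {linear tangent x -> R^o})
                            (fun k => dchart i x (b k))) }.

Definition zero_deformable (r s : nat) (t : tensor_field r s) : Prop :=
  forall x y, exists f : lin_iso (tangent x) (tangent y),
    tensor_map f (t x) = t y.

Section Projectivization.
Variables (m : nat) (r s : 'I_m -> nat).

(* The components of the tensor field [\sum_i t i] with respect to [p]. *)
Definition components (t : forall i, tensor_field (r i) (s i)) (x : M)
    (p : frame x) (i : 'I_m) : tensor 'cV[R]_n (r i) (s i) :=
  push (iso_inv p) p (t i x).

Definition given_by_projectivization (K : set 'M[R]_n)
    (P : forall x : M, set (frame x))
    (t : forall i, tensor_field (r i) (s i)) : Prop :=
  exists u : forall i, tensor 'cV[R]_n (r i) (s i),
  [/\ exists i, u i <> 0,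
      K = [set g | g \in unitmx /\
             exists2 c : R, c != 0 & forall i, rho g (u i) = c *: u i],
      forall x, exists i, t i x <> 0,
      forall x (p : frame x), exists g (c : R),
        [/\ g \in unitmx, c != 0 &
            forall i, components t p i = c *: rho g (u i)] &
      forall x (p : frame x), P x p <->
        exists2 c : R, c != 0 & forall i, components t p i = c *: u i].

End Projectivization.

End Structures.

(* Main.v *)
Require Import Defs.
From HB Require Import structures.
From mathcomp Require Import all_boot all_order all_algebra.
From mathcomp Require Import ring.
From mathcomp Require mpoly.
From mathcomp Require Import all_classical all_reals all_analysis.

(* By Noetherianity the algebraic group [G] is cut out of [GL_n] by the
   space [J] of polynomials of degree at most [d] on matrices that vanish on
   [G], for some [d].  An invertible [g] normalizes [G] if and only if [J] is
   stable under conjugation by [g], that is, if and only if [g] preserves the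
   line spanned by the top exterior power of [J] (Chevalley).  Polynomials of
   degree at most [d] are contractions of tensors of type [(d, d)], so this line
   is spanned by an inhomogeneous tensor [u], all of whose components have type
   [(e d, e d)].  Replacing [u] by the square of its product with the volume
   form makes the character of the normalizer on [u] positive and makes scalar
   matrices rescale [u] by all positive numbers.  Positivity allows one to glue
   the local fields with constant components [u] by means of positive bump
   functions, and the rescaling makes every component of the resulting field
   0-deformable.  In dimension 0 the constant function 1 will do. *)

Set Implicit Arguments.
Unset Strict Implicit.
Unset Printing Implicit Defensive.

Import Order.TTheory GRing.Theory Num.Theory.
Import numFieldNormedType.Exports.

Local Open Scope classical_set_scope.
Local Open Scope ring_scope.

(** * Noetherianity of polynomial ideals *)

Section Noetherian.
Import -(notations) mpoly.

(** The determinant of a basis of functions sampled at as many points stands for the top exterior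
    power: a change of basis multiplies it by a nonzero factor, and it is a tensor as soon as the
    functions are. For this reason the functions are tuples of tensors rather than polynomials.
    Contraction to polynomials is not injective but it is equivariant, so the space of tuples whose
    contraction vanishes on [G] still detects the normalizer.

    Two obstacles separate this line from a global field. Passing to another frame of the structure
    multiplies a field with constant components [u] by a value of the character; with negative
    values, sums of local fields could cancel. Even after gluing, the field is a positive function
    times [u] in frames of the structure, and this function is not constant, whereas 0-deformability
    asks for an exact match between any two points. A scalar matrix [a] acts on type [(r, s)] by the
    power [r - s] of [a]: it does nothing on type [(r, r)], but it realizes every positive ratio
    once [r] and [s] differ. This is why the volume form enters. *)

Lemma nat_nondecreasing_subseq (u : nat -> nat) : exists2 phi : nat -> nat,
  {homo phi : i j / (i < j)%N} & forall i j, (i <= j)%N -> (u (phi i) <= u (phi j))%N.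
Proof.
have tail_min a : exists b, (a <= b)%N /\ forall c, (a <= c)%N -> (u b <= u c)%N.
  have exv : exists v, `[< exists2 b, (a <= b)%N & u b = v >].
    by exists (u a); apply/asboolP; exists a.
  case: (ex_minnP exv) => v /asboolP[b ab <-] minv.
  by exists b; split=> // c ac; apply: minv; apply/asboolP; exists c.
have [s sP] := choice tail_min.
(* [phi] visits successive minimizers of tails: each value is minimal over a tail that contains all
   later indices. *)
pose phi k := iter k (fun i => s i.+1) (s 0%N).
have phi_mono : {homo phi : i j / (i < j)%N}.
  apply: homo_ltn => [j i k|i]; first exact: ltn_trans.
  by have [] := sP (phi i).+1.
exists phi => // i j; rewrite leq_eqVlt => /orP[/eqP-> //|ij].
have {}ij := phi_mono _ _ ij.
case: i ij => [|i] ij; first by have [_] := sP 0%N; apply.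
by have [iphi] := sP (phi i).+1; apply; apply: leq_trans (ltnW ij).
Qed.

(** Nondecreasing subsequences are extracted one exponent after another; monotonicity in the
    exponents already treated survives further extraction. *)
Lemma dickson (N : nat) (u : nat -> multinom N) :
  exists i j, (i < j)%N /\ forall k, (u i k <= u j k)%N.
Proof.
suff [phi phi1 phi2] : exists2 phi : nat -> nat, {homo phi : i j / (i < j)%N} &
    forall k, k \in enum 'I_N ->
    forall i j, (i <= j)%N -> (u (phi i) k <= u (phi j) k)%N.
  exists (phi 0%N), (phi 1%N); split=> [|k]; first exact: phi1.
  by apply: phi2; rewrite ?mem_enum.
elim: (enum 'I_N) => [|k ks [phi phi1 phi2]]; first by exists id.
have [psi psi1 psi2] := nat_nondecreasing_subseq (fun i => u (phi i) k).
exists (phi \o psi) => [i j ij|l]; first exact/phi1/psi1.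
rewrite inE => /predU1P[->|lks] i j ij; first exact: psi2.
apply: phi2 => //; move: ij; rewrite leq_eqVlt => /orP[/eqP-> //|ij].
exact/ltnW/psi1.
Qed.

Variables (R : fieldType) (N : nat).
Implicit Types f g : mpoly N R.

Lemma mlead_min (P : set (mpoly N R)) f : P f ->
  exists2 g, P g & forall h, P h -> ~~ (mlead h < mlead g)%O.
Proof.
move: {2}(mlead f) (erefl (mlead f)) => m; elim/(@well_founded_ind _ _ (@ltom_wf N)): m f.
move=> m IH f fm Pf.
have [[h [Ph hf]]|nex] := pselect (exists h, P h /\ (mlead h < mlead f)%O).
  by rewrite fm in hf; exact: IH hf _ erefl Ph.
by exists f => // h Ph; apply/negP => hf; apply: nex; exists h.
Qed.

Lemma mlead_sub_lt f g : f != 0 -> f - g != 0 -> mlead g = mlead f ->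
  mcoeff (mlead f) g = mcoeff (mlead f) f -> (mlead (f - g) < mlead f)%O.
Proof.
move=> f0 fg0 gf cfg; rewrite lt_neqAle; apply/andP; split; last first.
  by rewrite (le_trans (mleadB_le _ _)) // gf joinxx.
apply/negP => /eqP lE; move: fg0; rewrite -mleadc_eq0 lE mcoeffB cfg subrr.
by rewrite eqxx.
Qed.

(* Otherwise, choosing for each degree bound [d] a counterexample [f] of minimal
   leading monomial gives a sequence of leading monomials none of which divides
   a later one. *)
Lemma ideal_zeros_bounded_degree (I : set (mpoly N R)) :
    (forall f g h, I f -> I g -> I (f - h * g)) ->
  exists d, forall (x : 'I_N -> R),
    (forall g, I g -> (msize g <= d)%N -> meval x g = 0) ->
    forall f, I f -> meval x f = 0.
Proof.
move=> Iideal; apply: contrapT => nex.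
have bad d : exists fx : mpoly N R * ('I_N -> R), [/\ I fx.1, meval fx.2 fx.1 != 0,
    (forall g, I g -> (msize g <= d)%N -> meval fx.2 g = 0) &
    forall g, I g -> meval fx.2 g != 0 -> ~~ (mlead g < mlead fx.1)%O].
  have := nex; move/forallNP/(_ d)/existsNP => [x /not_implyP[xd]].
  move=> /existsNP[f /not_implyP[If /eqP fx]].
  have [g [Ig gx] ming] := @mlead_min [set g | I g /\ meval x g != 0] f (conj If fx).
  by exists (g, x); split=> // h Ih hx; apply: ming.
have [fx fxP] := choice bad.
(* Each bound dominates the sizes of all earlier counterexamples, so these vanish at the point
   chosen later. *)
pose d k := iter k (fun e => maxn e (msize (fx e).1)) 0%N.
have d_mono : {homo d : i j / (i <= j)%N}.
  by apply: homo_leq => [//|j i k|i]; [exact: leq_trans | exact: leq_maxl].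
have [i [j [ij le_ij]]] := dickson (fun k => mlead (fx (d k)).1).
have [Ii nzi _ _] := fxP (d i); have [Ij nzj zj minj] := fxP (d j).
set f := (fx (d j)).1 in Ij nzj zj minj le_ij; set x := (fx (d j)).2 in nzj zj minj.
set g := (fx (d i)).1 in Ii nzi le_ij.
have gx : meval x g = 0.
  by apply: zj => //; apply: leq_trans (d_mono _ _ ij); rewrite /= leq_maxr.
have f0 : f != 0 by apply: contraNneq nzj => ->; rewrite meval0.
have g0 : g != 0 by apply: contraNneq nzi => ->; rewrite meval0.
have le_gf : lem (mlead g) (mlead f) by apply/mnm_lepP.
(* Cancelling the leading term of [f] by a multiple of [g] does not change the value at [x], where
   [g] vanishes; the difference contradicts the minimality of [f]. *)
pose c := mcoeff (mlead f) f / mcoeff (mlead g) g.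
pose h := c *: mpolyX R (mnm_sub (mlead f) (mlead g)).
have c0 : c != 0 by rewrite mulf_neq0 ?invr_neq0 // mleadc_eq0.
have hl : mlead h = mnm_sub (mlead f) (mlead g) by rewrite mleadZ ?mleadXm.
have fl : mlead f = mnm_add (mlead h) (mlead g) by rewrite hl submK.
have h0 : h != 0 by rewrite -mleadc_eq0 hl mcoeffZ mcoeffX eqxx mulr1.
have hg0 : mlead (h * g) = mlead f by rewrite mleadM.
have hgc : mcoeff (mlead f) (h * g) = mcoeff (mlead f) f.
  rewrite {1}fl mleadcM hl mcoeffZ mcoeffX eqxx mulr1.
  by rewrite /c divfK // mleadc_eq0.
have fhg : meval x (f - h * g) != 0 by rewrite mevalB mevalM gx mulr0 subr0.
have := minj _ (Iideal f g h Ij Ii) fhg; rewrite mlead_sub_lt //.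
by apply: contraNneq fhg => ->; rewrite meval0.
Qed.

End Noetherian.

(** * Tensors *)

Section Multilinear.
Variables (R : realType) (V : lmodType R).

(** Stated for one kind of argument only, so that vector slots and covector slots (the latter
    parametrized by row vectors) are handled by the same lemmas. *)
Definition slotwise_linear r (F : ('I_r -> V) -> R) :=
  forall v k c a b, F [eta v with k |-> c *: a + b] =
    c * F [eta v with k |-> a] + F [eta v with k |-> b].

Lemma eta_with_same r (X : Type) (v : 'I_r -> X) k : ([eta v with k |-> v k] : 'I_r -> X) = v.
Proof. by apply/funext => l /=; case: eqP => // ->. Qed.

Lemma slotwise_linear_sum r (F : ('I_r -> V) -> R) (J : Type) (s : seq J)
    (c : J -> R) (w : J -> V) v k : slotwise_linear F ->
  F [eta v with k |-> \sum_(j <- s) c j *: w j] =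
  \sum_(j <- s) c j * F [eta v with k |-> w j].
Proof.
move=> Fl; elim: s => [|j s IH]; last by rewrite !big_cons Fl IH.
(* Linearity with scalar -1 at the zero vector forces the value 0 there. *)
rewrite !big_nil; have := Fl v k (-1) 0 0.
by rewrite scaler0 addr0 mulN1r addNr.
Qed.

Lemma slotwise_linearZ r (F : ('I_r -> V) -> R) (a : R) v : slotwise_linear F ->
  F (fun k => a *: v k) = a ^+ r * F v.
Proof.
move=> Fl.
suff: forall s : seq 'I_r, uniq s ->
    F (fun k => if k \in s then a *: v k else v k) = a ^+ size s * F v.
  move/(_ (enum 'I_r) (enum_uniq _)); rewrite size_enum_ord => <-; congr F.
  by apply/funext => k; rewrite mem_enum.
elim=> [|k s IH] /=; first by rewrite mul1r.
case/andP => ks /IH {}IH; set w := fun k => _ in IH.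
have := slotwise_linear_sum (tt :: nil) (fun=> a) (fun=> v k) w k Fl.
rewrite !big_seq1.
have -> : ([eta w with k |-> v k] : 'I_r -> V) = w.
  by rewrite -[RHS](eta_with_same w k) /w (negPf ks).
rewrite IH exprS -mulrA => <-; congr F; apply/funext => l /=.
by rewrite inE; case: eqP => [->|].
Qed.

Lemma slotwise_linear_eq r (F F' : ('I_r -> V) -> R) (J : finType) (w : J -> V) :
    slotwise_linear F -> slotwise_linear F' ->
    (forall x, exists c, x = \sum_j c j *: w j) ->
    (forall f : 'I_r -> J, F (w \o f) = F' (w \o f)) -> F =1 F'.
Proof.
move=> Fl F'l span eqw v.
(* The list [s] holds the slots not yet known to contain a generator; each induction step expands
   one of them. *)
suff: forall s : seq 'I_r, forall v, (forall k, k \notin s -> exists j, v k = w j) ->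
    F v = F' v.
  by move/(_ (enum 'I_r)); apply=> k; rewrite mem_enum.
elim=> [|k s IH] {}v vw.
  have [f fP] := choice (fun k => vw k isT).
  by have -> : v = w \o f by [apply/funext]; apply: eqw.
have [c cP] := span (v k); rewrite -(eta_with_same v k) cP !slotwise_linear_sum //.
apply: eq_bigr => j _; congr (_ * _); apply: IH => l ls /=.
by case: eqP => [_|/eqP lk]; [exists j | apply: vw; rewrite inE negb_or lk].
Qed.

Lemma prod_slotwise_linear r (h : 'I_r -> {linear V -> R^o}) :
  slotwise_linear (fun v => \prod_k h k (v k)).
Proof.
move=> v k c a b.
have E x : \prod_l h l (([eta v with k |-> x] : 'I_r -> V) l) =
    h k x * \prod_(l | l != k) h l (v l).
  rewrite (bigD1 k) //= eqxx; congr (_ * _).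
  by apply: eq_bigr => l /negPf ->.
by rewrite !E linearP mulrDl mulrA.
Qed.

Lemma slotwise_linear_expand r (F : ('I_r -> V) -> R) (J : finType) (w : J -> V)
    (h : J -> {linear V -> R^o}) :
    slotwise_linear F -> (forall x, x = \sum_j h j x *: w j) ->
    (forall i j, h i (w j) = (i == j)%:R) ->
  forall v, F v = \sum_(f : {ffun 'I_r -> J}) (\prod_k h (f k) (v k)) * F (w \o f).
Proof.
(* Both sides are multilinear, so it suffices to compare them on the vectors [w j], where duality
   leaves a single summand. *)
move=> Fl span hw; apply: (slotwise_linear_eq Fl _ (fun x => ex_intro _ _ (span x))).
  move=> v k c a b; rewrite mulr_sumr -big_split; apply: eq_bigr => f _ /=.
  rewrite (prod_slotwise_linear (fun k => h (f k)) v k c a b) mulrDl.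
  by rewrite mulrA.
move=> f; rewrite (bigD1 (finfun f)) //= [X in _ = X * _ + _]big1; last first.
  by move=> k _; rewrite ffunE hw eqxx.
rewrite mul1r big1 ?addr0 => [|f' f'f].
  by congr F; apply/funext => k /=; rewrite ffunE.
have /existsP[k kP] : [exists k, f' k != f k].
  apply: contraNT f'f => /existsPn f'f; apply/eqP/ffunP => k.
  by rewrite ffunE; apply/eqP; have := f'f k; rewrite negbK.
by rewrite (bigD1 k) //= hw (negPf kP) !mul0r.
Qed.

End Multilinear.

(** * Covectors as rows, and expansion of tensors in the standard basis *)

Section Covectors.
Variables (R : realType) (n : nat).

Definition dot (w : 'rV[R]_n) (v : 'cV[R]_n) : R^o := (w *m v) 0 0.

Lemma dot_is_linear w : linear (dot w).
Proof. by move=> c a b; rewrite /dot mulmxDr -scalemxAr !mxE. Qed.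

HB.instance Definition _ w := GRing.isLinear.Build R 'cV[R]_n R^o *:%R (dot w)
  (dot_is_linear w).

Definition covector (w : 'rV[R]_n) : {linear 'cV[R]_n -> R^o} := dot w.

Lemma covectorE w v : covector w v = (w *m v) 0 0. Proof. by []. Qed.

Lemma covector_delta i v : covector (delta_mx 0 i) v = v i 0.
Proof.
rewrite covectorE mxE (bigD1 i) //= mxE !eqxx mul1r big1 ?addr0 // => j /negPf ji.
by rewrite mxE ji andbF mul0r.
Qed.

Lemma covectorP (alpha : {linear 'cV[R]_n -> R^o}) :
  alpha = covector (\row_j alpha (delta_mx j 0)).
Proof.
apply: linear_eqP => v; rewrite covectorE mxE {1}[v]matrix_sum_delta linear_sum /=.
apply: eq_bigr => i _; rewrite big_ord1 linearZ /= mxE mulrC.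
by [].
Qed.

Lemma covector_mul w (g : 'M[R]_n) :
  (covector w \o mulmx g : {linear 'cV[R]_n -> R^o}) = covector (w *m g).
Proof. by apply: linear_eqP => v; rewrite /= !covectorE mulmxA. Qed.

Lemma covector_linear c a b :
  covector (c *: a + b) = ((c \*: covector a) \+ covector b : {linear 'cV[R]_n -> R^o}).
Proof.
apply: linear_eqP => v /=; rewrite !covectorE mulmxDl -scalemxAl !mxE.
by [].
Qed.

Definition col_coord i : {linear 'cV[R]_n -> R^o} := covector (delta_mx 0 i).

Definition row_coord_fun (i : 'I_n) (v : 'rV[R]_n) : R^o := v 0 i.
Lemma row_coord_is_linear i : linear (row_coord_fun i).
Proof. by move=> c a b; rewrite /row_coord_fun !mxE. Qed.
HB.instance Definition _ i := GRing.isLinear.Build R 'rV[R]_n R^o *:%R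
  (row_coord_fun i) (row_coord_is_linear i).
Definition row_coord i : {linear 'rV[R]_n -> R^o} := row_coord_fun i.

Lemma tensor_vec_linear (V : lmodType R) r s (T : tensor V r s) alpha :
  slotwise_linear (T alpha).
Proof. by move=> v k c a b; have /asboolP[_] := tensorP T; apply. Qed.

Lemma tensor_covec_linear r s (T : tensor 'cV[R]_n r s) v :
  slotwise_linear (fun w : 'I_r -> 'rV[R]_n => T (covector \o w) v).
Proof.
move=> w k c a b; have /asboolP[T1 _] := tensorP T.
have E x : covector \o [eta w with k |-> x] = [eta covector \o w with k |-> covector x].
  by apply/funext => l /=; case: eqP.
by rewrite !E covector_linear T1.
Qed.

(** The matrices [m k] stay outside the expansion, so that slots filled with a given matrix, its
    inverse or the identity can be treated together. *)
Lemma tensor_expand_vec r s (T : tensor 'cV[R]_n r s) (m : 'I_s -> 'M[R]_n) alpha v :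
  T alpha (fun k => m k *m v k) = \sum_(f : {ffun 'I_s -> 'I_n})
    (\prod_k v k (f k) 0) * T alpha (fun k => m k *m delta_mx (f k) 0).
Proof.
rewrite (@slotwise_linear_expand _ _ s (fun v => T alpha (fun k => m k *m v k)) _
  (fun j => delta_mx j 0) col_coord).
- apply: eq_bigr => f _; congr (_ * _); apply: eq_bigr => k _.
  by rewrite /col_coord covector_delta.
- move=> w k c a b.
  have E x : (fun l => m l *m [eta w with k |-> x] l) =
      [eta (fun l => m l *m w l) with k |-> m k *m x].
    by apply/funext => l /=; case: eqP => // ->.
  by rewrite !E mulmxDr -scalemxAr tensor_vec_linear.
- move=> x; rewrite {1}[x]matrix_sum_delta; apply: eq_bigr => i _.
  by rewrite big_ord1 /col_coord covector_delta.
- by move=> i j; rewrite /col_coord covector_delta mxE eqxx andbT.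
Qed.

Lemma tensor_expand_covec r s (T : tensor 'cV[R]_n r s) (alpha : 'I_r -> 'rV[R]_n) v :
  T (covector \o alpha) v = \sum_(f : {ffun 'I_r -> 'I_n})
    (\prod_k alpha k 0 (f k)) * T (fun k => covector (delta_mx 0 (f k))) v.
Proof.
rewrite (@slotwise_linear_expand _ _ r (fun w => T (covector \o w) v) _
  (fun j => delta_mx 0 j) row_coord).
- by apply: eq_bigr.
- exact: tensor_covec_linear.
- move=> x; rewrite {1}[x]matrix_sum_delta big_ord1; exact: eq_bigr.
- by move=> i j; rewrite /= /row_coord_fun mxE eqxx eq_sym.
Qed.

Lemma tensor_sumE (V : lmodType R) r s (J : Type) (q : seq J) (T : J -> tensor V r s)
    alpha v : (\sum_(j <- q) T j) alpha v = \sum_(j <- q) T j alpha v.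
Proof. by elim/big_rec2: _ => // j x y _ <-. Qed.

Lemma tensor_scaleE (V : lmodType R) r s c (T : tensor V r s) alpha v :
  (c *: T) alpha v = c * T alpha v.
Proof. by []. Qed.

Lemma tensor_eqP (V : lmodType R) r s (T S : tensor V r s) :
  (forall alpha v, T alpha v = S alpha v) -> T = S.
Proof. by move=> TS; apply/val_inj/funext => a; apply/funext => v; exact: TS. Qed.

End Covectors.
Arguments covector {R n}.

Section TensorConstructions.
Variables (R : realType) (V : lmodType R).
Local Notation dual := ({linear V -> R^o}).

Section Simple.
Variables (r s : nat) (a : 'I_r -> V) (b : 'I_s -> dual).

Definition simple_tensor_val (alpha : 'I_r -> dual) (v : 'I_s -> V) : R^o :=
  (\prod_k alpha k (a k)) * \prod_k b k (v k).

Lemma simple_tensor_subproof : simple_tensor_val \in @multilinear_pred R V r s.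
Proof.
apply/asboolP; split=> alpha v k c x y; rewrite /simple_tensor_val; last first.
  rewrite (prod_slotwise_linear b v k c x y).
  by rewrite mulrDr [in LHS]mulrCA.
have E z : \prod_l (([eta alpha with k |-> z] : 'I_r -> dual) l) (a l) =
    z (a k) * \prod_(l | l != k) alpha l (a l).
  rewrite (bigD1 k) //= eqxx; congr (_ * _).
  by apply: eq_bigr => l /negPf ->.
by rewrite !E /= !mulrDl !mulrA.
Qed.

Definition simple_tensor : tensor V r s := Tensor simple_tensor_subproof.
End Simple.

Section Product.
Variables (r s r' s' : nat) (T : tensor V r s) (S : tensor V r' s').

Definition tensor_prod_val (alpha : 'I_(r + r') -> dual) (v : 'I_(s + s') -> V) : R^o :=
  T (alpha \o @lshift _ _) (v \o @lshift _ _) *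
  S (alpha \o @rshift _ _) (v \o @rshift _ _).

Lemma eta_with_lshift p q (X : Type) (v : 'I_(p + q) -> X) k x :
  (([eta v with lshift q k |-> x] : 'I_(p + q) -> X) \o @lshift p q =
     [eta v \o @lshift p q with k |-> x] :> ('I_p -> X)) *
  (([eta v with lshift q k |-> x] : 'I_(p + q) -> X) \o @rshift p q =
     v \o @rshift p q).
Proof. by split; apply/funext => l /=; rewrite ?eq_lshift ?eq_rlshift. Qed.

Lemma eta_with_rshift p q (X : Type) (v : 'I_(p + q) -> X) k x :
  (([eta v with rshift p k |-> x] : 'I_(p + q) -> X) \o @rshift p q =
     [eta v \o @rshift p q with k |-> x] :> ('I_q -> X)) *
  (([eta v with rshift p k |-> x] : 'I_(p + q) -> X) \o @lshift p q =
     v \o @lshift p q).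
Proof. by split; apply/funext => l /=; rewrite ?eq_rshift ?eq_lrshift. Qed.

Lemma tensor_prod_subproof : tensor_prod_val \in @multilinear_pred R V (r + r') (s + s').
Proof.
have /asboolP[T1 T2] := tensorP T; have /asboolP[S1 S2] := tensorP S.
apply/asboolP; split=> alpha v k c x y; rewrite /tensor_prod_val.
  by case: (splitP k) => l kl; [have -> : k = lshift r' l by exact: val_inj
    |have -> : k = rshift r l by exact: val_inj];
    rewrite ?eta_with_lshift ?eta_with_rshift ?T1 ?S1; ring.
by case: (splitP k) => l kl; [have -> : k = lshift s' l by exact: val_inj
    |have -> : k = rshift s l by exact: val_inj];
    rewrite ?eta_with_lshift ?eta_with_rshift ?T2 ?S2; ring.
Qed.

Definition tensor_prod : tensor V (r + r') (s + s') := Tensor tensor_prod_subproof.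
End Product.

End TensorConstructions.

Section Volume.
Variables (R : realType) (n : nat).

Definition volume_val (_ : 'I_0 -> {linear 'cV[R]_n -> R^o}) (v : 'I_n -> 'cV[R]_n) : R^o :=
  \det (\matrix_(i, j) v i j 0).

Lemma volume_subproof : volume_val \in @multilinear_pred R 'cV[R]_n 0 n.
Proof.
apply/asboolP; split=> [? ? []//|alpha v k c a b].
pose mx x := \matrix_(i, j) ([eta v with k |-> x] : 'I_n -> 'cV[R]_n) i j 0.
rewrite /volume_val (determinant_multilinear (A := mx (c *: a + b)) (B := mx a)
  (C := mx b) (i0 := k) (b := c) (c := 1)).
- by rewrite mul1r.
- by apply/rowP => j; rewrite !mxE /= eqxx !mxE mul1r.
- by apply/matrixP => i j; rewrite !mxE /= eq_sym (negPf (neq_lift _ _)).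
- by apply/matrixP => i j; rewrite !mxE /= eq_sym (negPf (neq_lift _ _)).
Qed.

Definition volume : tensor 'cV[R]_n 0 n := Tensor volume_subproof.

Lemma rho_volume g : rho g volume = \det (invmx g) *: volume.
Proof.
apply: tensor_eqP => alpha v; rewrite tensor_scaleE /= /push_val /= /volume_val.
rewrite -[X in X * _]det_tr mulrC -det_mulmx; congr (\det _).
apply/matrixP => i j; rewrite !mxE; apply: eq_bigr => k _.
by rewrite !mxE mulrC.
Qed.

Lemma volume_delta alpha : volume alpha (fun i => delta_mx i 0) = 1.
Proof.
rewrite /= /volume_val -[RHS](det1 R n); congr (\det _).
by apply/matrixP => i j; rewrite !mxE andbT eq_sym.
Qed.

End Volume.

(** * The tensorial representation *)

Section Representation.
Variables (R : realType) (n : nat).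
Local Notation V := 'cV[R]_n.
Implicit Types (g h x : 'M[R]_n).

Lemma rho_linear r s g : linear (@rho R n r s g).
Proof. by move=> c T S; exact: tensor_eqP. Qed.
HB.instance Definition _ r s g := GRing.isLinear.Build R (tensor V r s)
  (tensor V r s) *:%R (@rho R n r s g) (@rho_linear r s g).

Lemma rho_mul r s g h (T : tensor V r s) : g \in unitmx -> h \in unitmx ->
  rho g (rho h T) = rho (g *m h) T.
Proof.
move=> gu hu; apply: tensor_eqP => alpha v; rewrite /rho /= /push_val /=.
congr (T _ _); apply/funext => k.
  by apply: linear_eqP => w /=; rewrite mulmxA.
rewrite /= mulmxA; congr (_ *m _).
apply: (can_inj (mulKmx (_ : g *m h \in unitmx))); first by rewrite unitmx_mul gu.
by rewrite mulmxV ?unitmx_mul ?gu // mulmxA mulmxK // mulmxV.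
Qed.

Lemma rho1 r s (T : tensor V r s) : rho 1%:M T = T.
Proof.
apply: tensor_eqP => alpha v; rewrite /rho /= /push_val; congr (T _ _).
  by apply/funext => k; apply: linear_eqP => w; rewrite /= mul1mx.
by apply/funext => k; rewrite invmx1 /= mul1mx.
Qed.

Lemma rhoK r s g (T : tensor V r s) : g \in unitmx -> rho (invmx g) (rho g T) = T.
Proof. by move=> gu; rewrite rho_mul ?unitmx_inv // mulVmx // rho1. Qed.

Lemma rho_prod r s r' s' g (T : tensor V r s) (S : tensor V r' s') :
  rho g (tensor_prod T S) = tensor_prod (rho g T) (rho g S).
Proof. exact: tensor_eqP. Qed.

(** Each covector slot contributes a factor [a] and each vector slot its inverse. *)
Lemma rho_scalar r s (a : R) (T : tensor V r s) : a != 0 ->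
  rho a%:M T = (a ^+ r * a ^- s) *: T.
Proof.
move=> a0; apply: tensor_eqP => alpha v; rewrite tensor_scaleE.
have -> : alpha = covector \o (fun k => \row_j alpha k (delta_mx j 0)).
  by apply/funext => k; exact: covectorP.
set w := (X in covector \o X); rewrite /rho /= /push_val.
have -> : (fun k => (covector \o w) k \o mulmx a%:M : {linear V -> R^o}) =
    covector \o (fun k => a *: w k).
  by apply/funext => k; rewrite /= covector_mul mul_mx_scalar.
rewrite (slotwise_linearZ _ _ (tensor_covec_linear T _)) -mulrA; congr (_ * _).
have -> : (fun k => invmx a%:M *m v k) = fun k => a^-1 *: v k.
  by apply/funext => k; rewrite invmx_scalar mul_scalar_mx.
by rewrite (slotwise_linearZ _ _ (tensor_vec_linear T _)) exprVn.
Qed.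

End Representation.

(** * Polynomials on matrices as contractions of tensors *)

Section Evaluation.
Import -(notations) mpoly.
Variables (R : realType) (n d : nat).
Local Notation V := 'cV[R]_n.
Implicit Types (x g : 'M[R]_n) (T : 'I_d.+1 -> tensor V d d).

(* The contraction of [T k] with [k] copies of [x] and [d - k] copies of the
   identity: every polynomial of degree at most [d] on matrices is obtained. *)
Definition tensor_eval T x : R :=
  \sum_k \sum_(f : {ffun 'I_d -> 'I_n})
    T k (fun l => covector (delta_mx 0 (f l)))
        (fun l => (if (l < k)%N then x else 1%:M) *m delta_mx (f l) 0).

Lemma tensor_eval_linear c T S x :
  tensor_eval (fun k => c *: T k + S k) x = c * tensor_eval T x + tensor_eval S x.
Proof.
rewrite /tensor_eval mulr_sumr -big_split; apply: eq_bigr => k _ /=.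
by rewrite mulr_sumr -big_split.
Qed.

(** Invariance of the trace: the factor [g] on the covector slots is expanded in the basis and,
    after exchanging the sums, reappears on the vector slots, next to [invmx g]. The two cancel in
    the identity slots and conjugate [x] in the others. Thus acting on tensors amounts to
    conjugating the argument of the polynomial. *)
Lemma tensor_eval_rho g T x : g \in unitmx ->
  tensor_eval (fun k => rho g (T k)) x = tensor_eval T (invmx g *m x *m g).
Proof.
move=> gu; apply: eq_bigr => k _; pose y (l : 'I_d) := if (l < k)%N then x else 1%:M.
transitivity (\sum_(f : {ffun 'I_d -> 'I_n}) \sum_(f' : {ffun 'I_d -> 'I_n})
    (\prod_l g (f l) (f' l)) * T k (fun l => covector (delta_mx 0 (f' l)))
        (fun l => invmx g *m y l *m delta_mx (f l) 0)).
  apply: eq_bigr => f _; rewrite /rho /= /push_val /=.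
  have -> : (fun l => covector (delta_mx 0 (f l)) \o mulmx g : {linear V -> R^o}) =
      covector \o (fun l => delta_mx 0 (f l) *m g).
    by apply/funext => l; rewrite /= covector_mul.
  rewrite tensor_expand_covec; apply: eq_bigr => f' _; congr (_ * _).
    by apply: eq_bigr => l _; rewrite -rowE mxE.
  by congr (T k _ _); apply/funext => l; rewrite mulmxA.
rewrite exchange_big; apply: eq_bigr => f' _ /=.
have -> : (fun l : 'I_d => (if (l < k)%N then invmx g *m x *m g else 1%:M) *m
      delta_mx (f' l) 0 : V) =
    fun l => (invmx g *m y l) *m (g *m delta_mx (f' l) 0).
  apply/funext => l; rewrite /y; case: ifP => _; first by rewrite !mulmxA.
  by rewrite mulmx1 mul1mx mulKmx.
rewrite tensor_expand_vec; apply: eq_bigr => f _; congr (_ * _).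
by apply: eq_bigr => l _; rewrite -colE mxE.
Qed.

Definition representable (f : 'M[R]_n -> R) := exists T, forall x, tensor_eval T x = f x.

Lemma representable0 : representable (fun=> 0).
Proof. by exists (fun=> 0) => x; apply: big1 => k _; apply: big1. Qed.

Lemma representable_linear c f h : representable f -> representable h ->
  representable (fun x => c * f x + h x).
Proof.
move=> [T TP] [S SP]; exists (fun k => c *: T k + S k) => x.
by rewrite tensor_eval_linear TP SP.
Qed.

Lemma representable_monomial (s : seq ('I_n * 'I_n)) : (0 < n)%N -> (size s <= d)%N ->
  representable (fun x => \prod_(t <- s) x t.1 t.2).
Proof.
(* The slot [l] of [S] extracts the matrix entry at the [l]-th pair of [s]. Slots beyond the length
   of [s] contain the identity matrix and use the pair [o], whose diagonal entry is 1. *)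
move=> n0 sd; pose o : 'I_n * 'I_n := (Ordinal n0, Ordinal n0).
pose S := simple_tensor (fun l : 'I_d => delta_mx (nth o s l).2 0 : V)
  (fun l : 'I_d => col_coord R (nth o s l).1).
exists (fun k => if k == size s :> nat then S else 0) => x.
have sd' : (size s < d.+1)%N by [].
rewrite /tensor_eval (bigD1 (Ordinal sd')) //= eqxx [X in _ + X]big1 ?addr0; last first.
  by move=> k; rewrite -val_eqE /= => /negPf ->; apply: big1.
pose y (l : 'I_d) := if (l < size s)%N then x else 1%:M.
rewrite (bigD1 [ffun l : 'I_d => (nth o s l).2]) //= [X in _ + X]big1 ?addr0; last first.
  move=> f fs; have /existsP[l fl] : [exists l : 'I_d, f l != (nth o s l).2].
    apply: contraNT fs => /existsPn fs; apply/eqP/ffunP => l.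
    by rewrite ffunE; apply/eqP; have := fs l; rewrite negbK.
  rewrite /= /simple_tensor_val (bigD1 l) //= covector_delta mxE (negPf fl) /=.
  by rewrite !mul0r.
rewrite /= /simple_tensor_val big1 ?mul1r => [|l _]; last first.
  by rewrite ffunE covector_delta mxE !eqxx.
transitivity (\prod_(l < d) y l (nth o s l).1 (nth o s l).2).
  by apply: eq_bigr => l _; rewrite /col_coord covector_delta ffunE -colE mxE.
rewrite (bigID (fun l : 'I_d => (l < size s)%N)) /= [X in _ * X]big1 ?mulr1; last first.
  move=> l ls; have -> : nth o s l = o by rewrite nth_default // leqNgt.
  by rewrite /y (negPf ls) mxE eqxx.
rewrite (big_nth o) big_mkord.
rewrite (big_ord_widen _ (fun l : nat => x (nth o s l).1 (nth o s l).2) sd).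
by apply: eq_bigr => l ls; rewrite /y ls.
Qed.

Lemma representable_mpoly (f : mpoly (n * n) R) : (0 < n)%N ->
    (msize f <= d.+1)%N ->
  representable (fun x => meval (fun k => mxvec x 0 k) f).
Proof.
move=> n0 fd.
have [k|q qP] := @boolp.choice _ _ (fun k (ij : 'I_n * 'I_n) =>
    forall x : 'M[R]_n, mxvec x 0 k = x ij.1 ij.2).
  by case/mxvec_indexP: k => i j; exists (i, j) => x; exact: mxvecE.
have -> : (fun x => meval (fun k => mxvec x 0 k) f) = fun x =>
    \sum_(m <- msupp f) mcoeff m f * \prod_(k < n * n)
      mxvec x 0 k ^+ fun_of_multinom m k.
  by apply/funext => x; rewrite mevalE.
have : {subset msupp f <= msupp f} by [].
elim: {1 3}(msupp f) => [_|m ms IH sub].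
  by under eq_fun do rewrite big_nil; exact: representable0.
under eq_fun do rewrite big_cons; apply: representable_linear; last first.
  by apply: IH => m' m'ms; apply: sub; rewrite inE m'ms orbT.
(* The variables of the monomial [m] listed with multiplicity, so that the length is its degree;
   [msize] exceeds the degree by one. *)
pose s := flatten [seq nseq (fun_of_multinom m k) (q k) | k <- enum 'I_(n * n)].
have sd : (size s <= d)%N.
  rewrite size_flatten /shape -map_comp (eq_map (g := fun_of_multinom m)); last first.
    by move=> k /=; rewrite size_nseq.
  rewrite sumnE big_map big_enum /= -mdegE -ltnS; apply: leq_trans fd.
  by apply: msize_mdeg_lt; apply: sub; rewrite inE eqxx.
have [T TP] := representable_monomial n0 sd; exists T => x; rewrite TP.
rewrite /s big_flatten big_map big_enum /=; apply: eq_bigr => k _.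
by rewrite big_nseq -qP iter_mulr_1.
Qed.

End Evaluation.

(** * Exterior powers of spaces of functions *)

Section Wedge.
Variables (R : realType) (Y : Type) (J : set (Y -> R)).
Hypothesis J0 : J (fun=> 0).
Hypothesis J_linear : forall c f h, J f -> J h -> J (fun y => c * f y + h y).

(** Its determinant is the exterior product of the [f i], seen as an alternating function of [e]
    points. *)
Definition sample e (f : 'I_e -> Y -> R) (z : 'I_e -> Y) : 'M[R]_e :=
  \matrix_(i, j) f i (z j).

Lemma combination_closed_sum (I : Type) (s : seq I) (a : I -> R) (f : I -> Y -> R) :
  (forall i, J (f i)) -> J (fun y => \sum_(i <- s) a i * f i y).
Proof.
move=> Jf; elim: s => [|i s IH].
  by under eq_fun do rewrite big_nil.
by under eq_fun do rewrite big_cons; exact: J_linear.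
Qed.

Lemma det_same_col e (A : 'M[R]_e) i j : i != j -> (forall k, A k i = A k j) -> \det A = 0.
Proof.
move=> ij Aij; rewrite -det_tr; apply: (determinant_alternate ij) => k.
by rewrite !mxE.
Qed.

(** A basis is read off from a nonzero minor of maximal size with columns among the finitely many
    points [y0 a]; a minor with a repeated column vanishes, which bounds the size. *)
Lemma finite_rank_basis (F : finType) (y0 : F -> Y) :
    (forall f, J f -> (forall a, f (y0 a) = 0) -> forall y, f y = 0) ->
  exists e (f : 'I_e -> Y -> R), [/\ forall i, J (f i),
    exists z, \det (sample f z) != 0 &
    forall h, J h -> exists a, forall y, h y = \sum_i a i * f i y].
Proof.
move=> inj.
pose P e := `[< exists (f : 'I_e -> Y -> R) (k : 'I_e -> F),
  (forall i, J (f i)) /\ \det (sample f (y0 \o k)) != 0 >].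
have exP : exists e, P e.
  (* The empty minor is 1. The map out of ['I_0] is defined by elimination, since [F] may be
     empty. *)
  exists 0%N; apply/asboolP; exists (fun=> fun=> 0),
    (fun i : 'I_0 => let: Ordinal _ lt_i0 := i in match notF lt_i0 with end).
  by split=> [[]//|]; rewrite det_mx00 oner_neq0.
have boundP e : P e -> (e <= #|F|)%N.
  move=> /asboolP[f [k [Jf dk]]]; rewrite -[e]card_ord; apply: (@leq_card _ _ k).
  move=> i j kij; apply/eqP; apply: contraNT dk => ij.
  by apply/eqP/(det_same_col ij) => l; rewrite !mxE /= kij.
case: (ex_maxnP exP boundP) => e /asboolP[f [k [Jf dk]]] maxe.
exists e, f; split=> [//||h Jh]; first by exists (y0 \o k).
set M := sample f _ in dk; have Mu : M \in unitmx by rewrite unitmxE unitfE.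
(* The combination with coefficients [a] interpolates [h] at the chosen points, so the remainder
   [h'] vanishes there. If [h'] were nonzero at some further point [b], bordering [M] by [h'] and
   [b] would give a larger block triangular minor that is nonzero. *)
pose a := (\row_j h (y0 (k j))) *m invmx M.
exists (a 0) => y; pose h' y := -1 * (\sum_i a 0 i * f i y) + h y.
have Jh' : J h' by apply: J_linear => //; exact: combination_closed_sum.
have h'k j : h' (y0 (k j)) = 0.
  have : (a *m M) 0 j = h (y0 (k j)) by rewrite mulmxKV // mxE.
  rewrite mxE /h' => <-; rewrite mulN1r addrC; apply/eqP; rewrite subr_eq0; apply/eqP.
  by apply: eq_bigr => i _; rewrite [M i j]mxE.
suff : h' y = 0 by rewrite /h' mulN1r addrC => /eqP; rewrite subr_eq0 => /eqP.
apply: inj => // b; apply/eqP; apply: contraT => h'b.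
suff : P (e + 1)%N by move/maxe; rewrite addn1 ltnn.
apply/asboolP; exists (fun i => match fintype.split i with inl i => f i | inr _ => h' end).
exists (fun i => match fintype.split i with inl i => k i | inr _ => b end); split.
  by move=> i; case: (fintype.split i) => [l|_]; [exact: Jf | exact: Jh'].
set A := sample _ _; suff -> : A = block_mx M (\col_i f i (y0 b)) 0 (h' (y0 b))%:M.
  by rewrite det_ublock det_scalar1 mulf_neq0.
rewrite -[A]submxK; congr block_mx; apply/matrixP => i j; rewrite !mxE /=.
- by rewrite !(unsplitK (inl _)).
- by rewrite (unsplitK (inl _)) (unsplitK (inr _)).
- by rewrite (unsplitK (inl _)) (unsplitK (inr _)).
- by rewrite !(unsplitK (inr _)) !ord1 mulr1n.
Qed.

Section Stabilizer.
Variables (e : nat) (f : 'I_e -> Y -> R).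
Hypothesis Jf : forall i, J (f i).
Variable z0 : 'I_e -> Y.
Hypothesis f_z0 : \det (sample f z0) != 0.
Hypothesis f_span : forall h, J h -> exists a, forall y, h y = \sum_i a i * f i y.

Definition wedge z := \det (sample f z).

(** Expansion along column [j]: with the other points fixed, the wedge is a combination of the
    [f i], hence an element of [J]. *)
Lemma wedge_slice z j y : wedge (fun k => if k == j then y else z k) =
  \sum_i f i y * cofactor (sample f z) i j.
Proof.
rewrite /wedge (expand_det_col _ j); apply: eq_bigr => i _; rewrite mxE eqxx.
congr (_ * (_ * \det _)); apply/matrixP => k l; rewrite !mxE.
by rewrite eq_sym (negPf (neq_lift _ _)).
Qed.

Variables (phi psi : Y -> Y).
Hypothesis phiK : forall y, phi (psi y) = y.

Lemma wedge_stable : (forall h, J h -> J (h \o phi)) ->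
  exists2 c, c != 0 & forall z, wedge (phi \o z) = c * wedge z.
Proof.
move=> Jphi; have [a aP] := boolp.choice (fun i => f_span (Jphi _ (Jf i))).
pose A := \matrix_(i, j) a i j.
have wA z : wedge (phi \o z) = \det A * wedge z.
  rewrite -det_mulmx; congr (\det _); apply/matrixP => i j; rewrite !mxE /=.
  by rewrite [LHS]aP; apply: eq_bigr => k _; rewrite !mxE.
(* If the determinant were 0, the wedge would vanish at every tuple in the image of [phi]; [z0] is
   one, because [phi] has the right inverse [psi]. *)
exists (\det A) => //; apply: contraNneq f_z0 => A0.
have := wA (psi \o z0); rewrite A0 mul0r => <-; apply/eqP; congr wedge.
by apply/funext => k /=; rewrite phiK.
Qed.

(** Cramer's rule recovers the functions from their wedge: the values [f i (phi y)] are combinations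
    of the wedges in which one point of [phi \o z0] is replaced by [phi y]. By hypothesis these are
    [c] times slices at [y], which lie in [J]. *)
Lemma stable_of_wedge c : c != 0 -> (forall z, wedge (phi \o z) = c * wedge z) ->
  forall h, J h -> J (h \o phi).
Proof.
move=> c0 wc h /f_span[a aP]; have -> : h = fun y => \sum_i a i * f i y by apply/funext.
suff Jfphi i : J (f i \o phi) by exact: (combination_closed_sum _ _ Jfphi).
set M := sample f (phi \o z0).
have M0 : \det M != 0 by rewrite -/(wedge _) wc mulf_neq0.
have E y : f i (phi y) = \sum_j M i j / \det M * c * \sum_k cofactor (sample f z0) k j * f k y.
  pose v := \col_k f k (phi y).
  have : v i 0 = ((\det M)^-1 *: (M *m (\adj M *m v))) i 0.
    by rewrite mulmxA mul_mx_adj mul_scalar_mx scalerA mulVf // scale1r.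
  rewrite {1}mxE => ->; rewrite mxE mxE mulr_sumr; apply: eq_bigr => j _.
  rewrite [M i j / _]mulrC -!mulrA; congr (_ * (_ * _)); rewrite mxE.
  transitivity (wedge (phi \o (fun k => if k == j then y else z0 k))).
    transitivity (wedge (fun k => if k == j then phi y else (phi \o z0) k)); last first.
      by congr wedge; apply/funext => k /=; case: eqP.
    by rewrite wedge_slice; apply: eq_bigr => k _; rewrite mxE [v _ _]mxE mulrC.
  by rewrite wc wedge_slice; congr (_ * _); apply: eq_bigr => k _; rewrite mulrC.
have -> : f i \o phi = fun y => \sum_j M i j / \det M * c *
    \sum_k cofactor (sample f z0) k j * f k y by apply/funext => y /=; rewrite E.
by apply: combination_closed_sum => j; exact: combination_closed_sum.
Qed.

End Stabilizer.
End Wedge.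

(** * The normalizer as the stabilizer of a line *)

Section WedgeTensor.
Variables (R : realType) (V : lmodType R) (K : Type) (d e : nat).
Local Notation dual := ({linear V -> R^o}).
Variables (T : 'I_e -> K -> tensor V d d).

(** An inhomogeneous tensor is encoded as one function of a component index, covectors and vectors,
    so that the wedge of functions applies to it. *)
Definition tensor_point := (K * ('I_d -> dual) * ('I_d -> V))%type.

Definition tensor_fun (S : K -> tensor V d d) (y : tensor_point) : R := S y.1.1 y.1.2 y.2.

Lemma mxvec_index_inj (p q : nat) (i i' : 'I_p) (j j' : 'I_q) :
  mxvec_index i j = mxvec_index i' j' -> i = i' /\ j = j'.
Proof. by move/cast_ord_inj/enum_rank_inj => []. Qed.

Lemma mxvec_indexK (p q : nat) : exists f : 'I_(p * q) -> 'I_p * 'I_q,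
  forall i j, f (mxvec_index i j) = (i, j).
Proof.
have [k|f fP] := @boolp.choice _ _ (fun (k : 'I_(p * q)) ij => k = mxvec_index ij.1 ij.2).
  by case/mxvec_indexP: k => i j; exists (i, j).
exists f => i j; have /mxvec_index_inj[] := fP (mxvec_index i j).
by case: (f _) => /= ? ? <- <-.
Qed.

Definition blocks (X : Type) (v : 'I_(e * d) -> X) j l : X := v (mxvec_index j l).

Lemma blocks_with (X : Type) (v : 'I_(e * d) -> X) j l x j' :
  blocks ([eta v with mxvec_index j l |-> x] : _ -> X) j' =
  if j' == j then [eta blocks v j with l |-> x] : _ -> X else blocks v j'.
Proof.
apply/funext => l'; rewrite /blocks /=; case: eqP => [/mxvec_index_inj[-> ->]|ne].
  by rewrite eqxx /= eqxx.
by case: eqP => [j'j|//]; rewrite -j'j /=; case: eqP => // l'l; case: ne; rewrite j'j l'l.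
Qed.

(** Once [kappa] fixes the component used at each of the [e] points, the wedge is multilinear in the
    remaining arguments, and all choices of [kappa] give the same type. Points index the rows, so
    that a slot affects a single row. *)
Definition wedge_tensor_val (kappa : 'I_e -> K) (alpha : 'I_(e * d) -> dual)
    (v : 'I_(e * d) -> V) : R^o :=
  \det (\matrix_(j, i) T i (kappa j) (blocks alpha j) (blocks v j)).

Lemma wedge_tensor_subproof kappa :
  wedge_tensor_val kappa \in @multilinear_pred R V (e * d) (e * d).
Proof.
have mult j0 (c : R) (A B C : 'I_e -> 'I_e -> R) :
    (forall i, A j0 i = c * B j0 i + C j0 i) ->
    (forall j i, j != j0 -> A j i = B j i) -> (forall j i, j != j0 -> A j i = C j i) ->
    \det (\matrix_(j, i) A j i) =
    c * \det (\matrix_(j, i) B j i) + \det (\matrix_(j, i) C j i).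
  move=> Aj0 AB AC.
  rewrite (determinant_multilinear (B := \matrix_(j, i) B j i)
    (C := \matrix_(j, i) C j i) (i0 := j0) (b := c) (c := 1)) ?mul1r //.
  - by apply/rowP => i; rewrite !mxE mul1r.
  - by apply/matrixP => j i; rewrite !mxE AB // eq_sym neq_lift.
  - by apply/matrixP => j i; rewrite !mxE AC // eq_sym neq_lift.
apply/asboolP; split=> alpha v k c a b; case/mxvec_indexP: k => j l;
  apply: (mult j) => [i|j' i /negPf j'j|j' i /negPf j'j]; rewrite !blocks_with ?eqxx ?j'j //.
  by have /asboolP[+ _] := tensorP (T i (kappa j)); apply.
by have /asboolP[_] := tensorP (T i (kappa j)); apply.
Qed.

Definition wedge_tensor kappa : tensor V (e * d) (e * d) := Tensor (wedge_tensor_subproof kappa).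

Lemma wedge_tensorE kappa alpha v : wedge_tensor kappa alpha v =
  wedge (fun i => tensor_fun (T i)) (fun j => (kappa j, blocks alpha j, blocks v j)).
Proof.
rewrite /wedge -det_tr; congr (\det _); apply/matrixP => i j.
by rewrite !mxE.
Qed.

(** Hence an identity between all the tensors [wedge_tensor T kappa] is the same as an identity
    between wedges at all tuples of points. *)
Lemma wedge_tensor_surj (z : 'I_e -> tensor_point) : exists kappa alpha v,
  forall j, z j = (kappa j, blocks alpha j, blocks v j).
Proof.
have [q qP] := mxvec_indexK e d.
exists (fun j => (z j).1.1), (fun p => (z (q p).1).1.2 (q p).2),
  (fun p => (z (q p).1).2 (q p).2) => j.
rewrite /blocks; case zj: (z j) => [[k alpha] v].
by congr (_, _, _); apply/funext => l; rewrite qP /= zj.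
Qed.

End WedgeTensor.

Section Normalizer.
Import -(notations) mpoly.
Variables (R : realType) (n : nat).
Local Notation V := 'cV[R]_n.
Hypothesis n_gt0 : (0 < n)%N.

(** Basis covectors and basis vectors provide the finite set of sample points for
    [finite_rank_basis]. *)
Lemma tensor_fun_eq0 d (S : 'I_d.+1 -> tensor V d d) :
  (forall a : 'I_d.+1 * {ffun 'I_d -> 'I_n} * {ffun 'I_d -> 'I_n},
     tensor_fun S (a.1.1, (fun l => covector (delta_mx 0 (a.1.2 l))),
       (fun l => delta_mx (a.2 l) 0)) = 0) ->
  forall y, tensor_fun S y = 0.
Proof.
move=> S0 [[k alpha] v]; rewrite /tensor_fun /=.
have -> : alpha = covector \o (fun k => \row_j alpha k (delta_mx j 0)).
  by apply/funext => l; exact: covectorP.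
have -> : v = fun l => 1%:M *m v l by apply/funext => l; rewrite mul1mx.
rewrite tensor_expand_covec; apply: big1 => f _.
rewrite tensor_expand_vec mulr_sumr; apply: big1 => f' _.
have -> : (fun l => 1%:M *m delta_mx (f' l) 0) = fun l => delta_mx (f' l) 0 : V.
  by apply/funext => l; rewrite mul1mx.
have E : S k (fun l => covector (delta_mx 0 (f l))) (fun l => delta_mx (f' l) 0) = 0.
  exact: (S0 (k, f, f')).
by rewrite E !mulr0.
Qed.

Definition point_act d (K : Type) (g : 'M[R]_n) (y : tensor_point V K d) : tensor_point V K d :=
  (y.1.1, (fun l => y.1.2 l \o mulmx g : {linear V -> R^o}), (fun l => invmx g *m y.2 l)).

Lemma point_actK d K g (y : tensor_point V K d) : g \in unitmx ->
  point_act g (point_act (invmx g) y) = y.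
Proof.
case: y => [[k alpha] v] gu; congr (_, _, _); apply/funext => l /=.
  by apply: linear_eqP => w /=; rewrite mulKmx.
by rewrite invmxK mulKmx.
Qed.

Lemma rho_wedge_tensor d e K (T : 'I_e -> K -> tensor V d d) kappa g alpha v :
  rho g (wedge_tensor T kappa) alpha v = wedge (fun i => tensor_fun (T i))
    (point_act g \o (fun j => (kappa j, blocks alpha j, blocks v j))).
Proof. exact: wedge_tensorE. Qed.

Lemma subgroup_normalizer (G : set 'M[R]_n) : subgroup G -> subgroup (normalizer G).
Proof.
move=> [Gu G1 GM GV]; split.
- by move=> g [].
- split; first exact: unitmx1.
  apply/seteqP; split=> [_ [h Gh <-]|h Gh]; first by rewrite invmx1 mul1mx mulmx1.
  by exists h; rewrite // invmx1 mul1mx mulmx1.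
- move=> g h [gu gG] [hu hG]; split; first by rewrite unitmx_mul gu.
  have ghE x : invmx (g *m h) *m x *m (g *m h) = invmx h *m (invmx g *m x *m g) *m h.
    have -> : invmx (g *m h) = invmx h *m invmx g.
      apply: (can_inj (mulKmx (_ : g *m h \in unitmx))); first by rewrite unitmx_mul gu.
      by rewrite mulmxV ?unitmx_mul ?gu // mulmxA mulmxK // mulmxV.
    by rewrite !mulmxA.
  rewrite -{2}hG -{2}gG; apply/seteqP; split=> [_ [x Gx <-]|_ [_ [x Gx <-] <-]].
    by exists (invmx g *m x *m g); [exists x|rewrite ghE].
  by exists x; rewrite ?ghE.
- move=> g [gu gG]; split; first by rewrite unitmx_inv.
  rewrite invmxK; apply/seteqP; split=> [_ [x Gx <-]|x Gx].
    have : G x by []. rewrite -{1}gG => -[y Gy <-].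
    by rewrite !mulmxA mulmxV // mul1mx mulmxK.
  exists (invmx g *m x *m g); first by rewrite -gG; exists x.
  by rewrite !mulmxA mulmxV // mul1mx mulmxK.
Qed.

(** The equality of sets becomes two inclusions, one for [g] and one for its inverse; each is a
    stability condition on a linear space of functions. *)
Lemma normalizerP (G : set 'M[R]_n) g : subgroup G -> g \in unitmx ->
  normalizer G g <-> forall x, G x -> G (invmx g *m x *m g) /\ G (g *m x *m invmx g).
Proof.
move=> sG gu; split=> [Ng x Gx|GJ].
  have [_ gG] := Ng; have [_ _ _ /(_ _ Ng)[_ gG']] := subgroup_normalizer sG.
  split; first by rewrite -gG; exists x.
  by rewrite -gG'; exists x; rewrite ?invmxK.
split=> //; apply/seteqP; split=> [_ [x /GJ[Gx _] <-]//|x /GJ[_ Gx]].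
by exists (g *m x *m invmx g); rewrite // !mulmxA mulVmx // mul1mx mulmxKV.
Qed.

(* Chevalley's construction: the normalizer is the stabilizer of the space of
   polynomials of degree at most [d] vanishing on [G], hence of the line
   spanned by its top exterior power. *)
Lemma normalizer_semi_invariant (G : set 'M[R]_n) : algebraic_subgroup G ->
  exists (I : finType) (r : nat) (u : I -> tensor V r r),
  (exists i, u i <> 0) /\ forall g, g \in unitmx ->
    (normalizer G g <-> exists2 c, c != 0 & forall i, rho g (u i) = c *: u i).
Proof.
move=> [sG [S GS]]; have [Gu _ _ _] := sG.
pose ev (x : 'M[R]_n) f := mpoly.meval (fun k => mxvec x 0 k) f : R.
pose I := [set f | forall x, G x -> ev x f = 0].
have I_ideal f g h : I f -> I g -> I (f - h * g).
  move=> If Ig x Gx; rewrite /ev mpoly.mevalB mpoly.mevalM -!/(ev x _).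
  by rewrite If // Ig // mulr0 subr0.
have [d dP] := ideal_zeros_bounded_degree I_ideal.
(* Tuples of tensors whose contraction vanishes on [G], including those with zero contraction. *)
pose J := [set h | exists2 T : 'I_d.+1 -> tensor V d d,
  forall x, G x -> tensor_eval T x = 0 & h = tensor_fun T].
have J0 : J (fun=> 0).
  by exists (fun=> 0) => // x _; apply: big1 => k _; apply: big1.
have J_linear c f h : J f -> J h -> J (fun y => c * f y + h y).
  move=> [T T0 ->] [T' T'0 ->]; exists (fun k => c *: T k + T' k) => // x Gx.
  by rewrite tensor_eval_linear T0 // T'0 // mulr0 addr0.
have J_act g : g \in unitmx -> (forall x, G x -> G (invmx g *m x *m g)) <->
    (forall h, J h -> J (h \o point_act g)).
  move=> gu; split=> [gG _ [T T0 ->]|gJ x Gx].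
    exists (fun k => rho g (T k)) => // x Gx; rewrite tensor_eval_rho // T0 //.
    exact: gG.
  apply/GS; first by rewrite !unitmx_mul unitmx_inv gu Gu.
  (* A polynomial of [I] of bounded degree is represented by a tuple in [J]; stability moves this
     tuple within [J], and equivariance reads off its value at the conjugate of [x]. The choice of
     [d] then extends the vanishing to all of [I], which contains the equations [S]. *)
  have evI f : I f -> (mpoly.msize f <= d)%N -> ev (invmx g *m x *m g) f = 0.
    move=> If fd; have [T TP] := representable_mpoly n_gt0 (leqW fd).
    have [|T' T'0 T'E] := gJ (tensor_fun T).
      by exists T => // y Gy; rewrite TP; exact: If.
    rewrite /ev -TP -tensor_eval_rho //.
    have -> : (fun k => rho g (T k)) = T'.
      apply/funext => k; apply: tensor_eqP => alpha v.
      exact: (congr1 (@^~ (k, alpha, v)) T'E).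
    exact: T'0.
  move=> f Sf; apply: dP evI _ _ => y Gy.
  by have /GS := Gy; apply => //; exact: Gu.
have [|e [f [Jf [z0 fz0] f_span]]] := @finite_rank_basis R _ J J0 J_linear _
    (fun a : 'I_d.+1 * {ffun 'I_d -> 'I_n} * {ffun 'I_d -> 'I_n} =>
       (a.1.1, (fun l => covector (delta_mx 0 (a.1.2 l))),
        (fun l => delta_mx (a.2 l) 0)) : tensor_point V _ _).
  by move=> _ [T _ ->]; exact: tensor_fun_eq0.
have [T TP] := boolp.choice (fun i => let: ex_intro2 T _ fT := Jf i in ex_intro _ T fT).
have {TP} fT : f = fun i => tensor_fun (T i) by apply/funext.
exists {ffun 'I_e -> 'I_d.+1}, (e * d)%N.
exists (fun kappa : {ffun _ -> _} => wedge_tensor T kappa); split.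
  have [kappa [alpha [v zE]]] := wedge_tensor_surj z0.
  exists (finfun kappa) => w0; move: fz0; rewrite fT.
  have -> : z0 = fun j => (finfun kappa j, blocks alpha j, blocks v j).
    by apply/funext => j; rewrite ffunE.
  by rewrite -[\det _](wedge_tensorE T (finfun kappa)) w0 eqxx.
move=> g gu; rewrite normalizerP //.
have wedgeP h c : (forall i : {ffun 'I_e -> 'I_d.+1},
    rho h (wedge_tensor T i) = c *: wedge_tensor T i) <->
    forall z, wedge f (point_act h \o z) = c * wedge f z.
  split=> [wc z|wc kappa].
    have [kappa [alpha [v zE]]] := wedge_tensor_surj z.
    have -> : z = fun j => (finfun kappa j, blocks alpha j, blocks v j).
      by apply/funext => j; rewrite ffunE.
    by rewrite fT -rho_wedge_tensor wc tensor_scaleE wedge_tensorE.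
  apply: tensor_eqP => alpha v.
  by rewrite rho_wedge_tensor tensor_scaleE wedge_tensorE -fT wc.
split=> [gG|[c c0 wc]].
  have gK y : point_act g (point_act (invmx g) y) = y := @point_actK d 'I_d.+1 g y gu.
  have /(J_act _ gu) Jg x : G x -> G (invmx g *m x *m g) by move/gG => [].
  have [c c0 wc] := wedge_stable Jf fz0 f_span gK Jg.
  by exists c => //; apply/wedgeP.
(* The inverse of [g] preserves the same line with factor [c^-1], which yields the second
   inclusion. *)
have wc' (i : {ffun 'I_e -> 'I_d.+1}) :
    rho (invmx g) (wedge_tensor T i) = c^-1 *: wedge_tensor T i :> tensor _ _ _.
  by rewrite -[in LHS](scalerK c0 (wedge_tensor T i)) linearZ /= -wc rhoK.
have stab h b : b != 0 -> h \in unitmx -> (forall i : {ffun 'I_e -> 'I_d.+1},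
    rho h (wedge_tensor T i) = b *: wedge_tensor T i) ->
    forall x, G x -> G (invmx h *m x *m h).
  move=> b0 hu /wedgeP wb; apply/(J_act _ hu).
  exact: (stable_of_wedge J0 J_linear Jf fz0 f_span b0 wb).
move=> x Gx; split; first exact: stab wc _ Gx.
by rewrite -{1}[g]invmxK; apply: stab wc' _ Gx; rewrite ?invr_neq0 ?unitmx_inv.
Qed.

End Normalizer.

(** * Making the character positive *)

Section PositiveCharacter.
Variables (R : realType) (n : nat).
Local Notation V := 'cV[R]_n.

Definition join_ord p q (X : Type) (v : 'I_p -> X) (w : 'I_q -> X) (k : 'I_(p + q)) : X :=
  match fintype.split k with inl i => v i | inr i => w i end.

Lemma tensor_prod_join (W : lmodType R) r s r' s' (T : tensor W r s) (S : tensor W r' s')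
    alpha alpha' v v' :
  tensor_prod T S (join_ord alpha alpha') (join_ord v v') = T alpha v * S alpha' v'.
Proof.
by congr (T _ _ * S _ _); apply/funext => k;
  rewrite /join_ord /= ?(unsplitK (inl _)) ?(unsplitK (inr _)).
Qed.

Lemma tensor_prodZ (W : lmodType R) r s r' s' (T : tensor W r s) (S : tensor W r' s') b c :
  tensor_prod (b *: T) (c *: S) = (b * c) *: tensor_prod T S.
Proof.
apply: tensor_eqP => alpha v; rewrite tensor_scaleE.
exact: (mulrACA b (T _ _) c (S _ _)).
Qed.

Lemma tensor_neq0 (W : lmodType R) r s (T : tensor W r s) : T <> 0 ->
  exists alpha v, T alpha v != 0.
Proof.
move=> T0; apply: contrapT => nex; apply: T0; apply: tensor_eqP => alpha v.
by apply/eqP; apply: contrapT => /negP Tav; apply: nex; exists alpha, v.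
Qed.

(** Evaluating the second factor where [w j] is nonzero isolates [w i]. The divisor
    [rho g (w j) beta z] is nonzero because its square is [b] times a nonzero square. *)
Lemma rho_prod_proportional (I : finType) r s (w : I -> tensor V r s) g b :
    (exists i, w i <> 0) -> b != 0 ->
    (forall i j, rho g (tensor_prod (w i) (w j)) = b *: tensor_prod (w i) (w j)) ->
  exists2 c, c != 0 & forall i, rho g (w i) = c *: w i.
Proof.
move=> [j /tensor_neq0[beta [z wj]]] b0 wb.
have E i alpha v : rho g (w i) alpha v * rho g (w j) beta z = b * (w i alpha v * w j beta z).
  have := congr1 (fun T : tensor _ _ _ => T (join_ord alpha beta) (join_ord v z)) (wb i j).
  by rewrite rho_prod tensor_scaleE !tensor_prod_join.
have rj : rho g (w j) beta z != 0.
  have : rho g (w j) beta z * rho g (w j) beta z != 0 by rewrite E !mulf_neq0.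
  by apply: contraNneq => ->; rewrite mul0r.
exists (b * w j beta z / rho g (w j) beta z); first by rewrite !mulf_neq0 ?invr_neq0.
move=> i; apply: tensor_eqP => alpha v; rewrite tensor_scaleE.
apply: (mulIf rj); rewrite E; field.
by [].
Qed.

Lemma normalizer_positive_semi_invariant (G : set 'M[R]_n) : (0 < n)%N -> algebraic_subgroup G ->
  exists (I : finType) (r s : nat) (u : I -> tensor V r s),
  [/\ r != s, exists i, u i <> 0,
    forall g, normalizer G g -> exists2 c, 0 < c & forall i, rho g (u i) = c *: u i &
    forall g c, g \in unitmx -> c != 0 -> (forall i, rho g (u i) = c *: u i) ->
      normalizer G g].
Proof.
move=> n0 /(normalizer_semi_invariant n0)[I [r [u [u0 uG]]]].
(* All products of two of the [w i] are used below: squares alone would let the factors of different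
   components differ by a sign. *)
pose w i := tensor_prod (u i) (volume R n).
(* The volume factor is stripped off by evaluating it on the standard basis. *)
have volE r' s' (T : tensor V r' s') alpha v : tensor_prod T (volume R n)
    (join_ord alpha (fun=> covector 0)) (join_ord v (fun i => delta_mx i 0)) = T alpha v.
  by rewrite tensor_prod_join volume_delta mulr1.
have w_neq0 : exists i, w i <> 0.
  have [i /tensor_neq0[alpha [v ui]]] := u0; exists i => wi0.
  by have := volE _ _ (u i) alpha v; rewrite -/(w i) wi0 => /esym/eqP; rewrite (negPf ui).
have wE g i : rho g (w i) = \det (invmx g) *: tensor_prod (rho g (u i)) (volume R n).
  by rewrite rho_prod rho_volume -[X in tensor_prod X _]scale1r tensor_prodZ mul1r.
exists (I * I)%type, (r + 0 + (r + 0))%N, (r + n + (r + n))%N.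
exists (fun ij => tensor_prod (w ij.1) (w ij.2)); split.
- by rewrite !addnn (inj_eq double_inj) eqn_add2l eq_sym -lt0n.
- have [i /tensor_neq0[alpha [v wi]]] := w_neq0; exists (i, i) => /= wi0.
  have := tensor_prod_join (w i) (w i) alpha alpha v v; rewrite wi0.
  by move/esym/eqP; rewrite mulf_eq0 !(negPf wi).
- move=> g Ng; have gu : g \in unitmx by case: Ng.
  have [c c0 uc] := (uG g gu).1 Ng.
  have w_c i : rho g (w i) = (\det (invmx g) * c) *: w i.
    by rewrite rho_prod rho_volume uc tensor_prodZ mulrC.
  exists ((\det (invmx g) * c) ^+ 2).
    rewrite exprn_even_gt0 //= mulf_neq0 //.
    by rewrite -unitfE -unitmxE unitmx_inv.
  by move=> [i j]; rewrite rho_prod !w_c tensor_prodZ expr2.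
- move=> g b gu b0 wb; apply/(uG _ gu).
  have [c c0 wc] := rho_prod_proportional w_neq0 b0 (fun i j => wb (i, j)).
  have d0 : \det (invmx g) != 0 by rewrite -unitfE -unitmxE unitmx_inv.
  exists (c / \det (invmx g)); first by rewrite mulf_neq0 ?invr_neq0.
  move=> i; apply: tensor_eqP => alpha v; rewrite tensor_scaleE.
  have := congr1 (fun T : tensor _ _ _ => T (join_ord alpha (fun=> covector 0))
    (join_ord v (fun i => delta_mx i 0))) (wc i).
  rewrite wE !tensor_scaleE !volE => dc.
  by rewrite mulrAC -dc mulrAC mulfV // mul1r.
Qed.
End PositiveCharacter.

(** * Smooth functions *)

Section CkCalculus.
Variables (R : realType) (V : normedModType R).

Lemma near_eq_diff (W : normedModType R) (f g : V -> W) x :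
  (\forall y \near x, f y = g y) -> differentiable f x ->
  differentiable g x /\ ('d g x = 'd f x :> (V -> W)).
Proof.
move=> fg /diff_locallyP[dfc dfE].
have gE : g \o shift x = cst (g x) + 'd f x +o_ 0 id.
  apply/eqaddoP => e e0; move: dfE => /eqaddoP/(_ e e0).
  have : \forall h \near (0 : V), f (h + x) = g (h + x).
    rewrite (near_shift x 0) sub0r /=; apply: filterS fg => y.
    by rewrite /= subrK.
  apply: filterS2 => h fgh; rewrite !fctE /= fgh.
  by rewrite (nbhs_singleton fg).
have dg := diff_unique dfc gE.
split; last exact: dg.
by apply/diff_locallyP; rewrite dg; split; [exact: dfc | exact: gE].
Qed.

Section Congruence.
Variables (W : normedModType R) (U : set V).
Hypothesis oU : open U.
Implicit Types f g : V -> W.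

Lemma near_open (P : V -> Prop) x : (forall y, U y -> P y) -> U x ->
  \forall y \near x, P y.
Proof. by move=> UP Ux; apply: filterS UP _; apply: open_nbhs_nbhs. Qed.

Lemma Ck_eq k f g : (forall x, U x -> f x = g x) -> Ck k U f -> Ck k U g.
Proof.
elim: k f g => [|k IH] f g fg.
  move=> /= fc x Ux; have fx : f y @[y --> x] --> f x := fc x Ux.
  change (g y @[y --> x] --> g x); rewrite -(fg _ Ux); apply: cvg_trans fx.
  by apply: near_eq_cvg; apply: near_open Ux => y /fg.
move=> [df Cdf]; have dfg x (Ux : U x) := near_eq_diff (near_open fg Ux) (df x Ux).
split=> [x Ux|v]; first by have [] := dfg x Ux.
apply: IH (Cdf v) => x Ux; have [_ dE] := dfg x Ux.
exact: esym (congr1 (@^~ v) dE).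
Qed.

Lemma CkW k f : Ck k.+1 U f -> Ck k U f.
Proof.
elim: k f => [|k IH] f [df Cdf].
  by move=> x Ux; apply: differentiable_continuous; exact: df.
by split=> // v; apply: IH; exact: Cdf.
Qed.

Lemma Ck_local k f : (forall x, U x -> exists N, [/\ open N, N x & Ck k N f]) -> Ck k U f.
Proof.
elim: k f => [|k IH] f fl.
  by move=> x Ux; have [N [_ Nx]] := fl x Ux; apply.
split=> [x Ux|v]; first by have [N [_ Nx [df _]]] := fl x Ux; exact: df.
apply: IH => x Ux; have [N [openN Nx [_ Cdf]]] := fl x Ux.
by exists N; split=> //; exact: Cdf.
Qed.

Lemma Ck_cst k (w : W) : Ck k U (fun=> w).
Proof.
elim: k w => [|k IH] w; first by move=> x _; exact: cvg_cst.
split=> [x _|v]; first exact: differentiable_cst.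
by apply: Ck_eq (IH 0) => x _; rewrite (diff_cst w x).
Qed.

Lemma CkD k f g : Ck k U f -> Ck k U g -> Ck k U (fun x => f x + g x).
Proof.
elim: k f g => [|k IH] f g.
  by move=> fc gc x Ux; apply: cvgD; [exact: fc | exact: gc].
move=> [df Cdf] [dg Cdg]; split=> [x Ux|v].
  by apply: differentiableD; [exact: df | exact: dg].
apply: Ck_eq (IH _ _ (Cdf v) (Cdg v)) => x Ux.
exact: esym (congr1 (fun h : V -> W => h v) (diffD (df x Ux) (dg x Ux))).
Qed.

Lemma Ck_sum k (I : Type) (s : seq I) (F : I -> V -> W) :
  (forall i, Ck k U (F i)) -> Ck k U (fun x => \sum_(i <- s) F i x).
Proof.
move=> CF; elim: s => [|i s IH].
  by apply: (Ck_eq _ (Ck_cst k 0)) => x _; rewrite big_nil.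
by apply: (Ck_eq _ (CkD (CF i) IH)) => x _; rewrite big_cons.
Qed.

End Congruence.

Section Scalar.
Variable U : set V.
Hypothesis oU : open U.
Implicit Types f g : V -> R^o.

Lemma Ck_const k (c : R) : Ck k U (fun=> c : R^o).
Proof. exact: Ck_cst. Qed.

Lemma CkM k f g : Ck k U f -> Ck k U g -> Ck k U (fun x => f x * g x : R^o).
Proof.
elim: k f g => [|k IH] f g.
  by move=> fc gc x Ux; apply: cvgM; [exact: fc | exact: gc].
move=> Cf Cg; have [df Cdf] := Cf; have [dg Cdg] := Cg; split=> [x Ux|v].
  by apply: differentiableM; [exact: df | exact: dg].
apply: (Ck_eq oU _ (CkD oU (IH _ _ (CkW Cf) (Cdg v)) (IH _ _ (CkW Cg) (Cdf v)))) => x Ux.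
exact: esym (congr1 (fun h : V -> R => h v) (diffM (df x Ux) (dg x Ux))).
Qed.

Lemma Ck_prod k (I : Type) (s : seq I) (F : I -> V -> R^o) :
  (forall i, Ck k U (F i)) -> Ck k U (fun x => \prod_(i <- s) F i x : R^o).
Proof.
move=> CF; elim: s => [|i s IH].
  by apply: (Ck_eq oU _ (Ck_const k 1)) => x _; rewrite big_nil.
by apply: (Ck_eq oU _ (CkM (CF i) IH)) => x _; rewrite big_cons.
Qed.

Lemma CkV k f : (forall x, U x -> f x != 0) -> Ck k U f -> Ck k U (fun x => (f x)^-1 : R^o).
Proof.
move=> f0; elim: k => [|k IH] Cf.
  by move=> x Ux; apply: cvgV; [exact: f0 | exact: Cf].
have [df Cdf] := Cf; split=> [x Ux|v].
  by apply: differentiableV; [exact: df | exact: f0].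
have CV := IH (CkW Cf).
apply: (Ck_eq oU _ (CkM (CkM (Ck_const k (-1)) (CkM CV CV)) (Cdf v))) => x Ux.
have E := congr1 (fun h : V -> R => h v) (diffV (df x Ux) (f0 x Ux)).
by rewrite [RHS]E /= expr2 invfM mulN1r.
Qed.

(** The whole family is carried along because the induction on [k] passes from [h i] to its
    derivative [h (D i)]. *)
Lemma Ck_comp_family (I : Type) (h : I -> R -> R) (D : I -> I) k f (i : I) :
    (forall i (t : R), is_derive t (1 : R) (h i) (h (D i) t)) ->
  Ck k U f -> Ck k U (fun x => h i (f x) : R^o).
Proof.
move=> hD; elim: k i f => [|k IH] i f Cf.
  move=> x Ux; apply: (@continuous_comp _ _ _ f (h i)); first exact: Cf.
  apply: differentiable_continuous; apply/derivable1_diffP.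
  exact: ex_derive.
have dh j t : differentiable (h j : R -> R^o) t by apply/derivable1_diffP; exact: ex_derive.
have [df Cdf] := Cf; split=> [x Ux|v].
  by apply: (@differentiable_comp _ _ _ _ f (h i)); [exact: df | exact: dh].
apply: (Ck_eq oU _ (CkM (Cdf v) (IH (D i) f (CkW Cf)))) => x Ux.
have E := congr1 (fun h : V -> R => h v) (diff_comp (df x Ux) (dh i (f x))).
have Ed := congr1 (@^~ ('d f x v)) (deriv1E (@ex_derive _ _ _ _ _ _ _ (hD i (f x)))).
rewrite [RHS]E /= [RHS]Ed derive1E derive_val.
by [].
Qed.

End Scalar.
End CkCalculus.

(** * Smooth functions vanishing on a half-line *)

Section FlatFunctions.
Variable R : realType.
Implicit Types (P : {poly R}) (t : R).

(** The polynomial factor in the inverse of [t] makes the family closed under derivation; [flat 1]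
    is the usual cutoff function. *)
Definition flat P t : R := if 0 < t then P.[t^-1] * expR (- t^-1) else 0.

(** With [y = t^-1] the derivation is [- y^2] times the derivation in [y], which sends
    [P * exp (- y)] to [(P' - P) * exp (- y)]. *)
Definition flat_deriv P : {poly R} := 'X^2 * (P - P^`()).

Lemma flat_npos P t : t <= 0 -> flat P t = 0.
Proof. by rewrite /flat leNgt => /negPf ->. Qed.

Lemma flat1_gt0 t : (0 < flat 1 t) = (0 < t).
Proof.
rewrite /flat; case: ifP => [t0|]; last by rewrite ltxx.
by rewrite hornerC mul1r expR_gt0.
Qed.

Lemma flat1_ge0 t : 0 <= flat 1 t.
Proof. by rewrite /flat; case: ifP => // _; rewrite hornerC mul1r expR_ge0. Qed.

Lemma expRN_inv_le k t : 0 < t -> expR (- t^-1) <= k`!%:R * t ^+ k.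
Proof.
move=> t0; have y0 : 0 < t^-1 by rewrite invr_gt0.
case: k => [|k].
  by rewrite mulr1 -[leRHS]expR0 ler_expR oppr_le0 ltW.
rewrite expRN -[leRHS]invrK lef_pV2 ?posrE ?expR_gt0 //; last first.
  by rewrite invr_gt0 mulr_gt0 ?exprn_gt0 // ltr0n fact_gt0.
apply: le_trans (expR_ge1Dxn k (ltW y0)).
by rewrite invfM mulrC exprVn lerDr ler01.
Qed.

(** Multiplying the polynomial by ['X] costs one power of [t], so the induction hypothesis is used
    at [k.+1]. *)
Lemma flat_bound P k : exists2 C, 0 <= C & forall t, 0 < t -> `|flat P t| <= C * t ^+ k.
Proof.
elim/poly_ind: P k => [|P c IH] k.
  by exists 0 => // t t0; rewrite /flat t0 horner0 !mul0r normr0.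
have [C C0 CP] := IH k.+1; exists (C + `|c| * k`!%:R).
  by rewrite addr_ge0 // mulr_ge0.
move=> t t0; have -> : flat (P * 'X + c%:P) t = flat P t * t^-1 + c * expR (- t^-1).
  by rewrite /flat t0 hornerD hornerMX hornerC mulrDl mulrAC.
rewrite mulrDl; apply: le_trans (ler_normD _ _) _; apply: lerD.
  rewrite normrM (@ger0_norm _ t^-1) ?invr_ge0 ?(ltW t0) // ler_pdivrMr // -mulrA -exprSr.
  exact: CP.
rewrite normrM -mulrA ler_wpM2l // ger0_norm ?expR_ge0 //.
exact: expRN_inv_le.
Qed.

Lemma flat_is_derive P t : is_derive t (1 : R) (flat P) (flat (flat_deriv P) t).
Proof.
have [t0|t0|->] := ltgtP t 0.
- have E : \forall s \near t, 0 = flat P s.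
    near=> s; rewrite flat_npos //; apply: ltW; near: s.
    by apply: lt_nbhsl.
  rewrite (flat_npos _ (ltW t0)).
  apply: DeriveDef; first by apply: (near_eq_derivable E); exact: derivable_cst.
  by rewrite -(near_eq_derive _ E) derive_cst.
- have E : \forall s \near t, P.[s^-1] * expR (- s^-1) = flat P s.
    near=> s; rewrite /flat ifT //; near: s.
    by apply: lt_nbhsr.
  have tn0 : t != 0 by rewrite gt_eqF.
  have D : is_derive t (1 : R) (fun s : R => P.[s^-1] * expR (- s^-1))
      (flat (flat_deriv P) t).
    have Di : is_derive t (1 : R) (fun s : R => s^-1) (- t ^- 2).
      by have := @is_deriveV R id t (1 : R) 1 tn0 (is_derive_id t 1); rewrite scaler1.
    have DP := @is_derive1_comp R (horner P) (fun s : R => s^-1) t _ _ (is_derive_poly P _) Di.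
    have DN : is_derive t (1 : R) (fun s : R => - s^-1) (t ^- 2).
      by have := is_deriveN Di; rewrite opprK.
    have DE := @is_derive1_comp R expR (fun s : R => - s^-1) t _ _ (is_derive_expR _) DN.
    apply: is_derive_eq (is_deriveM DP DE) _.
    rewrite /flat t0 /flat_deriv /GRing.scale /= hornerM hornerXn hornerD hornerN exprVn.
    ring.
  have [D1 D2] := D.
  apply: DeriveDef; first exact: (near_eq_derivable E).
  by rewrite -(near_eq_derive _ E).
rewrite (flat_npos _ (lexx 0)).
(* At the origin a quadratic bound suffices: the difference quotient is then at most [C] times the
   absolute value of [h]. *)
have [C C0 CP] := flat_bound P 2.
have L : h^-1 *: ((flat P \o shift 0) (h *: 1) - flat P 0) @[h --> 0^'] --> (0 : R).
  apply/cvgrPdist_le => e e0; near=> h.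
  have hC : `|h| * C <= e.
    apply: (@le_trans _ _ (`|h| * (C + 1))); first by rewrite ler_wpM2l // lerDl.
    rewrite -ler_pdivlMr ?ltr_wpDl //; near: h; apply: dnbhs0_le.
    by rewrite divr_gt0 // ltr_wpDl.
  rewrite sub0r normrN /= addr0 (flat_npos _ (lexx 0)) subr0 /GRing.scale /= mulr1.
  have [h0|h0] := leP h 0; first by rewrite flat_npos // mulr0 normr0 ltW.
  apply: le_trans hC; rewrite normrM normfV mulrC ler_pdivrMr ?normr_gt0 ?gt_eqF //.
  by rewrite (le_trans (CP _ h0)) // gtr0_norm // expr2 [leRHS]mulrAC mulrC.
apply: DeriveDef; first by apply/cvg_ex; exists 0.
exact: cvg_lim L.
Unshelve. all: by end_near.
Qed.

Lemma Ck_flat (V : normedModType R) (U : set V) k (f : V -> R^o) P :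
  open U -> Ck k U f -> Ck k U (fun x => flat P (f x) : R^o).
Proof.
by move=> oU; apply: (Ck_comp_family oU P flat_is_derive).
Qed.

End FlatFunctions.

Section MoreCk.
Variables (R : realType) (V : normedModType R).

Lemma Ck_subset (W : normedModType R) (U U' : set V) k (f : V -> W) :
  U' `<=` U -> Ck k U f -> Ck k U' f.
Proof.
move=> U'U; elim: k f => [|k IH] f; first by move=> Cf x /U'U; exact: Cf.
move=> [df Cdf]; split=> [x /U'U|v]; first exact: df.
by apply: IH; exact: Cdf.
Qed.

Lemma Ck_coord (U : set V) n k (f : V -> 'cV[R]_n) a :
  open U -> Ck k U f -> Ck k U (fun x => f x a 0 : R^o).
Proof.
move=> oU; pose e : {linear 'cV[R]_n -> R^o} := col_coord R a.
have ce : continuous e.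
  move=> v; have -> : (e : 'cV[R]_n -> R^o) = fun w => w a 0.
    by apply/funext => w; rewrite /e /col_coord covector_delta.
  exact: coord_continuous.
have eE w : e w = w a 0 by rewrite /e /col_coord covector_delta.
elim: k f => [|k IH] f Cf.
  move=> x Ux; apply: (@continuous_comp _ _ _ f (fun w : 'cV[R]_n => w a 0 : R^o)).
    exact: Cf.
  exact: coord_continuous.
have [df Cdf] := Cf; have -> : (fun x => f x a 0 : R^o) = e \o f.
  by apply/funext => x; rewrite -eE.
have de w : differentiable e w by exact: linear_differentiable.
split=> [x Ux|v]; first by apply: differentiable_comp; [exact: df | exact: de].
apply: (Ck_eq oU _ (IH _ (Cdf v))) => x Ux.
have E := congr1 (fun h : V -> R^o => h v) (diff_comp (df x Ux) (de (f x))).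
rewrite [RHS]E /= -eE.
by rewrite (congr1 (fun h : _ -> R^o => h ('d f x v)) (diff_lin (f x) ce)).
Qed.

End MoreCk.

(** * Smooth functions and tensor components on a manifold *)

Section SmoothFunctions.
Variables (R : realType) (n : nat) (M : manifold R n).
Implicit Types (O : set M) (f g : M -> R^o) (i j : chart_index M).

Lemma chart_image_open_sub O i : open O -> open (chart i @` (O `&` chart_dom i)).
Proof.
move=> oO; rewrite openE => _ [x [Ox xi] <-]; rewrite /interior.
have img : nbhs (chart i x) (chart i @` chart_dom i).
  by apply: open_nbhs_nbhs; split; [exact: chart_image_open | exists x].
apply: filterS2 img (near_chart xi oO Ox) => _ [y yi <-]; rewrite chartK // => Oy.
by exists y.
Qed.

Lemma smooth_on_eq (W : normedModType R) O (f g : M -> W) : open O ->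
  (forall x, O x -> f x = g x) -> smooth_on O f -> smooth_on O g.
Proof.
move=> oO fg sf i k; apply: Ck_eq (sf i k); first exact: chart_image_open_sub.
by move=> _ [x [Ox xi] <-]; rewrite /= chartK //; exact: fg.
Qed.

Lemma smooth_on_subset (W : normedModType R) O O' (f : M -> W) : O' `<=` O ->
  smooth_on O f -> smooth_on O' f.
Proof.
move=> O'O sf i k; apply: Ck_subset (sf i k) => _ [x [Ox xi] <-].
by exists x => //; split=> //; exact: O'O.
Qed.

Lemma smooth_on_local (W : normedModType R) O (f : M -> W) :
  (forall x, O x -> exists N, [/\ open N, N x & smooth_on N f]) -> smooth_on O f.
Proof.
move=> fl i k; apply: Ck_local => _ [x [Ox xi] <-].
have [N [oN Nx sf]] := fl x Ox; exists (chart i @` (N `&` chart_dom i)).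
by split; [exact: chart_image_open_sub | exists x | exact: sf].
Qed.

Lemma smooth_on_coord O (f : M -> 'cV[R]_n) a : open O -> smooth_on O f ->
  smooth_on (V := R^o) O (fun x => f x a 0).
Proof.
move=> oO sf i k; apply: (Ck_coord a _ (sf i k)).
exact: chart_image_open_sub.
Qed.

Lemma smooth_on_chart i a : smooth_on (V := R^o) (chart_dom i) (fun x => chart i x a 0).
Proof.
apply: smooth_on_coord; first exact: chart_dom_open.
move=> j k; apply: Ck_subset (@transition_smooth _ _ M j i k) => _ [x [xi xj] <-].
by exists x.
Qed.

Section Algebra.
Variable O : set M.
Hypothesis oO : open O.
Local Notation sm := (smooth_on (V := R^o) O).

Lemma smooth_on_cst (c : R) : sm (fun=> c).
Proof. by move=> i k; apply: Ck_const; exact: chart_image_open_sub. Qed.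

Lemma smooth_onD f g : sm f -> sm g -> sm (fun x => f x + g x).
Proof. by move=> sf sg i k; apply: CkD; [exact: chart_image_open_sub|exact: sf|exact: sg]. Qed.

Lemma smooth_onM f g : sm f -> sm g -> sm (fun x => f x * g x : R^o).
Proof. by move=> sf sg i k; apply: CkM; [exact: chart_image_open_sub|exact: sf|exact: sg]. Qed.

Lemma smooth_onB f g : sm f -> sm g -> sm (fun x => f x - g x).
Proof.
move=> sf sg; apply: (smooth_on_eq oO _ (smooth_onD sf (smooth_onM (smooth_on_cst (-1)) sg))).
by move=> x _; rewrite mulN1r.
Qed.

Lemma smooth_on_sum (I : Type) (s : seq I) (F : I -> M -> R^o) :
  (forall l : I, sm (F l)) -> sm (fun x => \sum_(l <- s) F l x).
Proof.
move=> sF i k; have C l : Ck k (chart i @` (O `&` chart_dom i)) (F l \o ichart i) := sF l i k.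
exact: (Ck_sum (chart_image_open_sub oO) s C).
Qed.

Lemma smooth_on_prod (I : Type) (s : seq I) (F : I -> M -> R^o) :
  (forall l : I, sm (F l)) -> sm (fun x => \prod_(l <- s) F l x : R^o).
Proof.
move=> sF i k; have C l : Ck k (chart i @` (O `&` chart_dom i)) (F l \o ichart i) := sF l i k.
exact: (Ck_prod (chart_image_open_sub oO) s C).
Qed.

Lemma smooth_onV f : (forall x, O x -> f x != 0) -> sm f -> sm (fun x => (f x)^-1 : R^o).
Proof.
move=> f0 sf i k; apply: CkV; [exact: chart_image_open_sub| |exact: sf].
by move=> _ [x [Ox xi] <-]; rewrite /= chartK //; exact: f0.
Qed.

Lemma smooth_on_flat P f : sm f -> sm (fun x => flat P (f x) : R^o).
Proof. by move=> sf i k; apply: Ck_flat; [exact: chart_image_open_sub | exact: sf]. Qed.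

Lemma smooth_on_det m (A : M -> 'M[R]_m) : (forall a c, sm (fun x => A x a c)) ->
  sm (fun x => \det (A x)).
Proof.
move=> sA; rewrite /determinant; apply: smooth_on_sum => s.
by apply: smooth_onM; [exact: smooth_on_cst | exact: smooth_on_prod].
Qed.

Lemma smooth_on_invmx m (A : M -> 'M[R]_m) a c : (forall x, O x -> A x \in unitmx) ->
  (forall a c, sm (fun x => A x a c)) -> sm (fun x => invmx (A x) a c).
Proof.
move=> Au sA.
have sadj : sm (fun x => (\det (A x))^-1 * ((-1) ^+ (c + a) * \det (row' c (col' a (A x))))).
  apply: smooth_onM.
    apply: smooth_onV; last exact: smooth_on_det.
    by move=> x /Au; rewrite unitmxE unitfE.
  apply: smooth_onM; first exact: smooth_on_cst.
  apply: smooth_on_det => a' c'.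
  by apply: (smooth_on_eq oO _ (sA (lift c a') (lift a c'))) => x _; rewrite !mxE.
by apply: (smooth_on_eq oO _ sadj) => x Ox; rewrite /invmx Au // !mxE.
Qed.

End Algebra.

Lemma smooth_on_continuous O f x : open O -> O x -> smooth_on O f -> {for x, continuous f}.
Proof.
move=> oO Ox sf; have [i xi] := chart_dom_cover x.
have c1 : {for chart i x, continuous (f \o ichart i)} by apply: (sf i 0%N); exists x.
have c2 := chart_continuous xi.
have c : {for x, continuous ((f \o ichart i) \o chart i)} by exact: continuous_comp.
change (f y @[y --> x] --> f x).
have -> : f x = ((f \o ichart i) \o chart i) x by rewrite /= chartK.
apply: cvg_trans c; apply: near_eq_cvg.
have : nbhs x (chart_dom i) by apply: open_nbhs_nbhs; split=> //; exact: chart_dom_open.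
by apply: filterS => y yi /=; rewrite chartK.
Qed.

Section FrameComponents.
Variables (i : chart_index M).

Definition frame_matrix (x : M) (p : frame x) : 'M[R]_n :=
  \matrix_(a, c) Defs.coord i (p (delta_mx c 0)) a 0.

Lemma frame_matrixE x (p : frame x) w : Defs.coord i (p w) = frame_matrix p *m w.
Proof.
apply/colP => a; rewrite {1}[w]matrix_sum_delta linear_sum /= linear_sum /= summxE mxE.
by apply: eq_bigr => c _; rewrite big_ord1 !linearZ /= !mxE mulrC.
Qed.

Lemma frame_matrix_unit x (p : frame x) : chart_dom i x -> frame_matrix p \in unitmx.
Proof.
move=> xi; pose B := \matrix_(a, c) iso_inv p (of_coord i x (delta_mx c 0)) a 0 : 'M[R]_n.
suff /mulmx1_unit[] : frame_matrix p *m B = 1%:M by [].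
apply/matrixP => a c.
transitivity ((frame_matrix p *m iso_inv p (of_coord i x (delta_mx c 0))) a 0).
  by rewrite !mxE; apply: eq_bigr => k _; rewrite [B _ _]mxE.
by rewrite -frame_matrixE iso_invK of_coordK // !mxE andbT.
Qed.

Lemma iso_inv_frame x (p : frame x) v : chart_dom i x ->
  iso_inv p v = invmx (frame_matrix p) *m Defs.coord i v.
Proof.
move=> xi; apply: (can_inj (mulKmx (frame_matrix_unit p xi))).
by rewrite -frame_matrixE iso_invK mulKVmx // frame_matrix_unit.
Qed.

(** In a chart these values are polynomials in the entries of the frame matrix and of its
    inverse. *)
Lemma smooth_on_push (U : set M) (p : forall x, frame x) r s (u : tensor 'cV[R]_n r s)
    (a : 'I_r -> 'I_n) (b : 'I_s -> 'I_n) : open U -> smooth_frame_field U p ->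
  smooth_on (V := R^o) (U `&` chart_dom i)
    (fun x => push (p x) (iso_inv (p x)) u
      (fun k => dcoord i (a k) : {linear tangent x -> R^o}) (fun k => dchart i x (b k))).
Proof.
move=> oU sp; have oUi : open (U `&` chart_dom i) by apply: openI => //; exact: chart_dom_open.
pose A x := frame_matrix (p x).
have sA c d : smooth_on (V := R^o) (U `&` chart_dom i) (fun x => A x c d).
  apply: (smooth_on_eq oUi _ (smooth_on_coord c oUi (sp i d))) => x _.
  by rewrite mxE.
have sF : smooth_on (V := R^o) (U `&` chart_dom i) (fun x =>
    \sum_(f : {ffun 'I_r -> 'I_n}) (\prod_k A x (a k) (f k)) *
     (\sum_(f' : {ffun 'I_s -> 'I_n}) (\prod_k invmx (A x) (f' k) (b k)) *
       u (fun k => covector (delta_mx 0 (f k))) (fun k => 1%:M *m delta_mx (f' k) 0))).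
  apply: smooth_on_sum => // f; apply: smooth_onM => //.
    by apply: smooth_on_prod => // k; exact: sA.
  apply: smooth_on_sum => // f'; apply: smooth_onM => //; last exact: smooth_on_cst.
  apply: smooth_on_prod => // k; apply: smooth_on_invmx => //.
  by move=> x [_ xi]; exact: frame_matrix_unit.
apply: (smooth_on_eq oUi _ sF) => x [_ xi]; rewrite /push /= /push_val.
have -> : (fun k => dcoord i (a k) \o p x : {linear _ -> R^o}) =
    covector \o (fun k => row (a k) (A x)).
  apply/funext => k; apply: linear_eqP => w /=; rewrite /dcoord frame_matrixE covectorE.
  by rewrite -row_mul [RHS]mxE.
rewrite tensor_expand_covec; apply: eq_bigr => f _; congr (_ * _).
  by apply: eq_bigr => k _; rewrite [row _ _ _ _]mxE.
have -> : (fun k => iso_inv (p x) (dchart i x (b k))) =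
    fun k => 1%:M *m (invmx (A x) *m delta_mx (b k) 0).
  apply/funext => k; rewrite mul1mx (iso_inv_frame _ _ xi) /dchart of_coordK //.
rewrite tensor_expand_vec; apply: eq_bigr => f' _; congr (_ * _).
by apply: eq_bigr => k _; rewrite -colE mxE.
Qed.

End FrameComponents.
End SmoothFunctions.

(** * Bump functions *)

Section Bumps.
Variables (R : realType) (n : nat) (M : manifold R n).

Lemma compact_cube (c : 'cV[R]_n) (e : R) :
  compact [set v : 'cV[R]_n | forall a, `|c a 0 - v a 0| <= e].
Proof.
pose B := [set v : 'rV[R]_n | forall a, `[c a 0 - e, c a 0 + e]%classic (v 0 a)].
have cB : compact B.
  exact: (@rV_compact R n (fun a => `[c a 0 - e, c a 0 + e]%classic)
    (fun a => @segment_compact R _ _)).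
have ct : continuous (fun v : 'rV[R]_n => v^T : 'cV[R]_n).
  move=> v; apply/(cvg_ballP (FF := nbhs_filter v)) => d d0.
  apply: (@filterS _ (nbhs v) (nbhs_filter v) _ _ _ (nbhsx_ballx v d d0)) => w [_ vw].
  by split=> // a j; rewrite !mxE; exact: vw.
have := continuous_compact (continuous_subspaceT ct) cB.
congr compact; apply/seteqP; split=> [_ [v Bv <-] a|v Cv].
  by rewrite mxE distrC ler_distl; have := Bv a; rewrite /= in_itv.
exists v^T; last by rewrite trmxK.
by move=> a /=; rewrite in_itv /= mxE -ler_distl distrC; exact: Cv.
Qed.

(** The last clause says that the support of [a] lies in [U]. The threshold 1 is the one at which a
    bump cuts off the later weights in the gluing. *)
Lemma bump_exists (x : M) (U : set M) : open U -> U x ->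
  exists a : M -> R^o, [/\ smooth_on (V := R^o) setT a, forall y, 0 <= a y, 1 < a x &
    forall y, U y \/ exists N, [/\ open N, N y & forall z, N z -> a z = 0]].
Proof.
move=> oU Ux; have [i xi] := chart_dom_cover x; pose c := chart i x.
have oUi : open (U `&` chart_dom i) by apply: openI => //; exact: chart_dom_open.
have : nbhs c (chart i @` (U `&` chart_dom i)).
  by apply: open_nbhs_nbhs; split; [exact: chart_image_open_sub | exists x].
move=> /nbhs_ballP[d /= d0 dU]; pose e := d / 2.
have e0 : 0 < e by rewrite divr_gt0.
pose C := [set v : 'cV[R]_n | forall a, `|c a 0 - v a 0| <= e].
have CU v : C v -> (chart i @` (U `&` chart_dom i)) v.
  move=> Cv; apply: dU; split=> // a j; rewrite ord1.
  by apply: le_lt_trans (Cv a) _; rewrite ltr_pdivrMr // ltr_pMr // ltr1n.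
pose D := ichart i @` C.
(* Compactness and the Hausdorff property make [D] closed in the whole manifold and not just in the
   chart domain; this is what makes the extension by 0 smooth. *)
have cD : closed D.
  apply: compact_closed; first exact: points_hausdorff.
  apply: (continuous_compact _ (@compact_cube c e)).
  apply: continuous_in_subspaceT => v /set_mem/CU[y [Uy yi] <-].
  by apply: ichart_continuous; exists y.
have DU y : D y -> U y by move=> [_ /CU[z [Uz zi] <-] <-]; rewrite chartK.
pose s y : R := \sum_a (chart i y a 0 - c a 0) ^+ 2.
have s_ge0 y : 0 <= s y by apply: sumr_ge0 => a _; exact: sqr_ge0.
have sD y : chart_dom i y -> s y < e ^+ 2 -> D y.
  move=> yi sy; exists (chart i y); last by rewrite chartK.
  move=> a; rewrite distrC -ler_sqr ?nnegrE ?(ltW e0) // real_normK ?num_real //.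
  apply: ltW; apply: le_lt_trans sy; rewrite /s (bigD1 a) //= lerDl.
  by apply: sumr_ge0 => b _; exact: sqr_ge0.
(* This normalization gives the bump the value 2 at [x]. *)
pose h := 2 / flat 1 (e ^+ 2).
have he : 0 < flat 1 (e ^+ 2) by rewrite flat1_gt0 exprn_gt0.
pose a y : R^o := if pselect (chart_dom i y) then h * flat 1 (e ^+ 2 - s y) else 0.
have aD y : ~ D y -> a y = 0.
  move=> Dy; rewrite /a; case: pselect => // yi.
  rewrite flat_npos ?mulr0 // subr_le0 leNgt; apply/negP => /(sD _ yi).
  exact: Dy.
exists a; split.
- apply: smooth_on_local => y _; have [yi|yi] := pselect (chart_dom i y).
    exists (chart_dom i); split=> //; first exact: chart_dom_open.
    have oi := @chart_dom_open _ _ M i.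
    have sm : smooth_on (V := R^o) (chart_dom i) (fun z => h * flat 1 (e ^+ 2 - s z)).
      apply: smooth_onM => //; first exact: smooth_on_cst.
      apply: smooth_on_flat => //; apply: smooth_onB => //; first exact: smooth_on_cst.
      apply: smooth_on_sum => // b.
      have sc : smooth_on (V := R^o) (chart_dom i) (fun z => chart i z b 0 - c b 0).
        by apply: smooth_onB => //; [exact: smooth_on_chart | exact: smooth_on_cst].
      exact: (smooth_onM oi sc sc).
    by apply: (smooth_on_eq oi _ sm) => z zi; rewrite /a; case: pselect.
  exists (~` D); have oD : open (~` D) by exact: closed_openC.
  split=> //; first by move=> [_ /CU[z [_ zi] <-] zy]; apply: yi; rewrite -zy chartK.
  by apply: (smooth_on_eq oD _ (smooth_on_cst oD 0)) => z Dz; rewrite aD.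
- move=> y; rewrite /a; case: pselect => // ?.
  by rewrite mulr_ge0 ?flat1_ge0 // divr_ge0 // ltW.
- rewrite /a; case: pselect => // ?.
  have -> : s x = 0 by rewrite /s big1 // => b _; rewrite subrr expr0n.
  by rewrite subr0 /h divfK ?gt_eqF // ltr1n.
- move=> y; have [Dy|Dy] := pselect (D y); [left; exact: DU | right].
  by exists (~` D); split=> //; exact: closed_openC.
Qed.

Variable P : forall x : M, set (frame x).
Hypothesis P_local : forall x, exists U (p : forall y, frame y),
  [/\ open U, U x, smooth_frame_field U p & forall y, U y -> P (p y)].

(** The frame field is total, with arbitrary values where the bump vanishes; it is smooth near every
    point of the support. *)
Definition framed_bump (a : M -> R^o) (p : forall x, frame x) :=
  [/\ smooth_on (V := R^o) setT a, forall y, 0 <= a y, forall y, 0 < a y -> P (p y) &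
    forall y, (exists N, [/\ open N, N y & smooth_frame_field N p]) \/
              (exists N, [/\ open N, N y & forall z, N z -> a z = 0])].

Lemma framed_bump_exists x : exists a p, framed_bump a p /\ 1 < a x.
Proof.
have [U [p [oU Ux sp Pp]]] := P_local x.
have [a [sa a0 ax aU]] := bump_exists oU Ux; exists a, p; split=> //; split=> //.
  move=> y ay; apply: Pp; have [//|[N [_ Ny /(_ _ Ny) aN]]] := aU y.
  by rewrite aN ltxx in ay.
by move=> y; have [Uy|?] := aU y; [left; exists U | right].
Qed.

(** A Lindelof argument: every basic open set on which some framed bump exceeds 1 selects such a
    bump, and by continuity these sets cover the manifold. *)
Lemma countable_framed_bumps : exists (a : nat -> M -> R^o) (p : nat -> forall x, frame x),
  (forall k, framed_bump (a k) (p k)) /\ forall x, exists k, 1 < a k x.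
Proof.
have [B /countable_injP[f finj] [oB Bx]] := @points_second_countable _ _ M.
(* Default frames for the indices that code no such basic set; they are paired with the zero
   bump. *)
have p0 : forall x : M, frame x.
  by move=> x; have [U /cid[p _]] := cid (P_local x); exact: p x.
have good k : exists ap : (M -> R^o) * (forall x, frame x), framed_bump ap.1 ap.2 /\
    forall V, B V -> f V = k ->
     (exists a p, framed_bump a p /\ V `<=` [set y | 1 < a y]) -> V `<=` [set y | 1 < ap.1 y].
  have [[V [BV fV [a [p [gap aV]]]]]|nV] := pselect (exists V, [/\ B V, f V = k &
      exists a p, framed_bump a p /\ V `<=` [set y | 1 < a y]]).
    exists (a, p); split=> // V' BV' fV' _.
    by have -> : V' = V by apply: finj; rewrite ?inE // fV'.
  exists (fun=> 0, p0); split; last by move=> V BV fV ap; case: nV; exists V.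
  split=> //=; [exact: (smooth_on_cst openT)|by move=> y; rewrite ltxx|].
  by move=> y; right; exists setT; split=> //; exact: openT.
have [ap apP] := boolp.choice good.
exists (fun k => (ap k).1), (fun k => (ap k).2); split; first by move=> k; have [] := apP k.
move=> x; have [a [p [gap ax]]] := framed_bump_exists x; have [sa _ _ _] := gap.
have ca : {for x, continuous a} by exact: (smooth_on_continuous openT I sa).
have : nbhs x [set y | 1 < a y].
  apply: (ca [set r | 1 < r]); exact: (lt_nbhsr ax).
move=> /Bx[V [BV Vx] Va]; exists (f V).
by have [_ /(_ V BV erefl)] := apP (f V); apply => //; exists a, p.
Qed.

End Bumps.

(** * Gluing *)

Section Frames.
Variables (R : realType) (n : nat) (M : manifold R n).
Local Notation V := 'cV[R]_n.
Implicit Types x y : M.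

Definition push_frame r s (x : M) (p : frame x) (T : tensor V r s) : tensor (tangent x) r s :=
  push p (iso_inv p) T.

Lemma push_frameZ r s x (p : frame x) c (T : tensor V r s) :
  push_frame p (c *: T) = c *: push_frame p T.
Proof. exact: tensor_eqP. Qed.

Lemma componentsZ r s x (p : frame x) c (T : tensor (tangent x) r s) :
  push (iso_inv p) p (c *: T) = c *: push (iso_inv p) p T.
Proof. exact: tensor_eqP. Qed.

Lemma push_frameK r s x (p : frame x) (T : tensor V r s) :
  push (iso_inv p) p (push_frame p T) = T.
Proof.
apply: tensor_eqP => alpha v /=; rewrite /push_val /=; congr (T _ _).
  by apply/funext => k; apply: linear_eqP => w /=; rewrite iso_funK.
by apply/funext => k; rewrite iso_funK.
Qed.

Lemma frame_change x (p q : frame x) : exists2 g, g \in unitmx & frame_act p g q.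
Proof.
pose mat (f : {linear V -> V}) : 'M[R]_n := \matrix_(a, c) f (delta_mx c 0) a 0.
have matE (f : {linear V -> V}) w : f w = mat f *m w.
  apply/colP => a; rewrite {1}[w]matrix_sum_delta linear_sum /= summxE mxE.
  by apply: eq_bigr => c _; rewrite big_ord1 linearZ /= !mxE mulrC.
pose f := iso_inv p \o q : {linear V -> V}; pose f' := iso_inv q \o p : {linear V -> V}.
have ff' : mat f *m mat f' = 1%:M.
  apply/matrixP => a c.
  have : mat f *m (mat f' *m delta_mx c 0) = delta_mx c 0 :> V.
    by rewrite -!matE /= iso_invK iso_funK.
  move=> /(congr1 (fun w : V => w a 0)); rewrite mulmxA -colE !mxE andbT.
  by [].
exists (mat f); first by have [] := mulmx1_unit ff'.
by rewrite /frame_act => w; rewrite -(matE f) /= iso_invK.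
Qed.

Lemma frame_act_inv x (p q : frame x) g : g \in unitmx -> frame_act p g q ->
  frame_act q (invmx g) p.
Proof. by move=> gu pq w; rewrite pq mulKVmx. Qed.

Lemma push_frame_act r s x (p q : frame x) g (T : tensor V r s) : g \in unitmx ->
  frame_act p g q -> push_frame q T = push_frame p (rho g T).
Proof.
move=> gu pq; apply: tensor_eqP => alpha v /=; rewrite /push_val /= /push_val /=.
congr (T _ _); first by apply/funext => k; apply: linear_eqP => w /=; rewrite pq.
apply/funext => k; apply: (can_inj (iso_funK q)).
by rewrite iso_invK pq mulKVmx // iso_invK.
Qed.

Definition scaled_frame_iso x y (p : frame x) (q : frame y) (a : R) (a0 : a != 0) :
  lin_iso (tangent x) (tangent y).
Proof.
refine (@LinIso R (tangent x) (tangent y)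
  (q \o (mulmx a%:M \o iso_inv p) : {linear _ -> _})
  (p \o (mulmx (a^-1)%:M \o iso_inv q) : {linear _ -> _}) _ _).
- by move=> v /=; rewrite iso_funK mulmxA -scalar_mxM mulVf // mul1mx iso_invK.
- by move=> v /=; rewrite iso_funK mulmxA -scalar_mxM mulfV // mul1mx iso_invK.
Defined.

Lemma tensor_map_scaled_frame_iso x y (p : frame x) (q : frame y) a (a0 : a != 0)
    r s (T : tensor V r s) :
  tensor_map (scaled_frame_iso p q a0) (push_frame p T) = push_frame q (rho a%:M T).
Proof.
apply: tensor_eqP => alpha v /=; rewrite /push_val /= /push_val /=; congr (T _ _).
  by apply/funext => k; apply: linear_eqP => w /=; rewrite iso_funK.
by apply/funext => k; rewrite iso_funK invmx_scalar.
Qed.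

Lemma positive_scaling (r s : nat) (b : R) : r != s -> 0 < b ->
  exists2 a, a != 0 & a ^+ r * a ^- s = b.
Proof.
(* The exponential of [y] is the positive root of [a ^ (r - s) = b], where the integer exponent may
   be negative. *)
move=> rs b0; pose y := ln b / (r%:R - s%:R).
have rs0 : r%:R - s%:R != 0 :> R by rewrite subr_eq0 eqr_nat.
exists (expR y); first by rewrite gt_eqF ?expR_gt0.
rewrite -!expRM_natl -expRN -expRD -mulrBl mulrC divfK // lnK //.
Qed.

End Frames.

(** * The glued field *)

Section Construction.
Variables (R : realType) (n : nat) (M : manifold R n).
Local Notation V := 'cV[R]_n.
Implicit Types x y : M.
Variables (K : set 'M[R]_n) (P : forall x : M, set (frame x)).
Hypothesis K_unit : forall g, K g -> g \in unitmx.
Hypothesis KP : K_structure K P.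
Variables (I : Type) (r s : nat) (u : I -> tensor V r s).
Hypothesis u_character : forall g, K g -> exists2 c, 0 < c & forall i, rho g (u i) = c *: u i.
Variables (a : nat -> M -> R^o) (p : nat -> forall x, frame x).
Hypothesis a_bump : forall k, framed_bump P (a k) (p k).
Hypothesis a_cover : forall x, exists k, 1 < a k x.

(* The weights form a locally finite family, since [weight k] vanishes where
   [a j > 1] for some [j < k]. *)
Definition weight k (x : M) : R^o := a k x * \prod_(j < k) flat 1 (1 - a j x).

Definition cover_index x : nat := projT1 (cid (a_cover x)).

Lemma cover_indexP x : 1 < a (cover_index x) x.
Proof. by rewrite /cover_index; case: cid. Qed.

(** Morally the sum over all [k]: the weights beyond [cover_index x] vanish at [x], so the arbitrary
    choice in the truncation does not matter. *)
Definition glued i (x : M) : tensor (tangent x) r s :=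
  \sum_(k < (cover_index x).+1) weight k x *: push_frame (p k x) (u i).

Lemma weight_ge0 k x : 0 <= weight k x.
Proof.
have [_ a0 _ _] := a_bump k; rewrite mulr_ge0 //.
by apply: prodr_ge0 => j _; exact: flat1_ge0.
Qed.

Lemma weight_eq0 j k x : (j < k)%N -> 1 < a j x -> weight k x = 0.
Proof.
move=> jk aj; rewrite /weight (bigD1 (Ordinal jk)) //= flat_npos ?mul0r ?mulr0 //.
by rewrite subr_le0 ltW.
Qed.

(** Allows one fixed truncation on the whole open set where [a j] exceeds 1, although [cover_index]
    need not be locally constant. *)
Lemma glued_eq i j x : 1 < a j x ->
  glued i x = \sum_(k < j.+1) weight k x *: push_frame (p k x) (u i).
Proof.
have trunc l m : (l < m)%N -> 1 < a l x ->
    \sum_(k < m) weight k x *: push_frame (p k x) (u i) =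
    \sum_(k < l.+1) weight k x *: push_frame (p k x) (u i).
  move=> lm al; pose F k := weight k x *: push_frame (p k x) (u i).
  rewrite -!(big_mkord xpredT F) (@big_cat_nat _ _ _ l.+1) //= [X in _ + X]big_nat_cond.
  rewrite [X in _ + X]big1 ?addr0 // => k /andP[/andP[lk _] _].
  by rewrite /F (weight_eq0 lk al) scale0r.
move=> aj; have ac := cover_indexP x; rewrite /glued.
rewrite -(trunc _ (maxn j (cover_index x)).+1 _ ac) ?ltnS ?leq_maxr //.
by rewrite (trunc _ _ _ aj) // ltnS leq_maxl.
Qed.

(** Frames carrying a positive weight lie in [P], hence differ from [q] by elements of [K], whose
    characters are positive; the factor [f] is common to all components because the character is. *)
Lemma glued_frame x (q : frame x) : P q ->
  exists2 f, 0 < f & forall i, glued i x = f *: push_frame q (u i).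
Proof.
move=> Pq; have ratio k : exists c, [/\ 0 <= c, a k x != 0 -> 0 < c &
    forall i, a k x *: push_frame (p k x) (u i) = (a k x * c) *: push_frame q (u i)].
  have [_ a0 aP _] := a_bump k.
  have [->|ak] := eqVneq (a k x) 0.
    by exists 0; split=> // i; rewrite mul0r !scale0r.
  have /aP Pp : 0 < a k x by rewrite lt_neqAle eq_sym ak a0.
  have [/(_ x q (p k x) Pq)[/(_ Pp) [g Kg qg] _] _] := KP.
  have [c c0 uc] := u_character Kg; exists c; split=> [||i]; [exact: ltW|by []|].
  by rewrite (push_frame_act _ (K_unit Kg) qg) uc push_frameZ scalerA.
have [c cP] := boolp.choice ratio.
exists (\sum_(k < (cover_index x).+1) weight k x * c k); last first.
  move=> i; rewrite /glued scaler_suml; apply: eq_bigr => k _.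
  have [_ _ E] := cP k.
  by rewrite /weight [_ * \prod_(j < k) _]mulrC -!scalerA E -scalerA.
have exk : exists k, a k x != 0.
  by exists (cover_index x); rewrite gt_eqF // (lt_trans _ (cover_indexP x)).
(* The first nonzero bump has positive weight: all earlier bumps vanish at [x], so every cutoff
   factor is [flat 1 1]. The other summands are nonnegative. *)
have [j aj minj] := ex_minnP exk.
have jc : (j < (cover_index x).+1)%N.
  by rewrite ltnS; apply: minj; rewrite gt_eqF // (lt_trans _ (cover_indexP x)).
rewrite (bigD1 (Ordinal jc)) //= ltr_pwDl //; last first.
  by apply: sumr_ge0 => k _; rewrite mulr_ge0 ?weight_ge0 //; have [] := cP k.
have [_ /(_ aj) c0 _] := cP j; rewrite mulr_gt0 // /weight mulr_gt0 //.
  by have [_ a0 _ _] := a_bump j; rewrite lt_neqAle eq_sym aj a0.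
apply: prodr_gt0 => l _; have -> : a l x = 0.
  by apply/eqP; apply: contraTT (ltn_ord l) => /minj; rewrite -leqNgt.
by rewrite subr0 flat1_gt0.
Qed.

Lemma smooth_weight k : smooth_on (V := R^o) setT (weight k).
Proof.
have sa j : smooth_on (V := R^o) setT (a j) by have [] := a_bump j.
apply: smooth_onM => //; first exact: openT.
apply: smooth_on_prod => [|j]; first exact: openT.
apply: smooth_on_flat; first exact: openT.
by apply: smooth_onB => //; [exact: openT | apply: smooth_on_cst; exact: openT].
Qed.

Lemma glued_smooth l i (b : 'I_r -> 'I_n) (d : 'I_s -> 'I_n) :
  smooth_on (V := R^o) (chart_dom i) (fun x => glued l x
    (fun k => dcoord i (b k) : {linear tangent x -> R^o}) (fun k => dchart i x (d k))).
Proof.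
pose comp k (x : M) : R^o := push_frame (p k x) (u l)
    (fun k => dcoord i (b k) : {linear tangent x -> R^o}) (fun k => dchart i x (d k)).
have oi := @chart_dom_open _ _ M i.
have s_term k : smooth_on (V := R^o) (chart_dom i) (fun x => weight k x * comp k x : R^o).
  apply: smooth_on_local => x xi; have [_ _ _ /(_ x)[[N [oN Nx sN]]|[N [oN Nx aN]]]] := a_bump k.
    have oNi : open (N `&` chart_dom i) by exact: openI.
    exists (N `&` chart_dom i); split=> //.
    apply: smooth_onM => //; last exact: smooth_on_push.
    by apply: smooth_on_subset (smooth_weight k).
  exists N; split=> //; apply: (smooth_on_eq oN _ (smooth_on_cst oN 0)) => y Ny.
  by rewrite /weight aN // !mul0r.
apply: smooth_on_local => x xi; pose c := cover_index x.
have [sa _ _ _] := a_bump c.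
have oN : open [set y | 1 < a c y].
  rewrite openE => y ay; have ca : {for y, continuous (a c)}.
    exact: (smooth_on_continuous openT Logic.I sa).
  exact: (ca [set t | 1 < t] (lt_nbhsr ay)).
have oNi : open ([set y | 1 < a c y] `&` chart_dom i) by exact: openI.
exists ([set y | 1 < a c y] `&` chart_dom i); split=> //.
  by split=> //; exact: cover_indexP.
have sm : smooth_on (V := R^o) ([set y | 1 < a c y] `&` chart_dom i)
    (fun y => \sum_(k < c.+1) (weight k y * comp k y)).
  apply: smooth_on_sum => // k; apply: smooth_on_subset (s_term k).
  by move=> y [].
apply: (smooth_on_eq oNi _ sm) => y [ay _]; rewrite (glued_eq _ ay) tensor_sumE.
by apply: eq_bigr.
Qed.

Definition glued_field i : tensor_field M r s := TensorField (glued_smooth i).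

End Construction.

Lemma projectivization_dim_gt0 (R : realType) (n : nat) (G : set 'M[R]_n)
    (M : manifold R n) (P : forall x : M, set (frame x)) :
    (0 < n)%N -> algebraic_subgroup G -> K_structure (normalizer G) P ->
  exists (m : nat) (r s : 'I_m -> nat) (t : forall i : 'I_m, tensor_field M (r i) (s i)),
    (forall i, zero_deformable (t i)) /\ given_by_projectivization (normalizer G) P t.
Proof.
move=> n0 hG hP; have [P_act P_local] := hP; have [sG _] := hG.
have [I [r [s [u [rs [i0 ui0] uN Nu]]]]] := normalizer_positive_semi_invariant n0 hG.
have [a [p [a_bump a_cover]]] := countable_framed_bumps P_local.
have [Nunit _ _ NV] := subgroup_normalizer sG.
pose t i := glued_field u a_bump a_cover i.
have t_frame := glued_frame Nunit hP uN a_bump a_cover.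
have P_ex x : exists q, P x q.
  by have [U [q [_ Ux _ Pq]]] := P_local x; exists (q x); exact: Pq.
exists #|I|, (fun=> r), (fun=> s), (fun i => t (enum_val i)); split.
  move=> i x y; have [q Pq] := P_ex x; have [q' Pq'] := P_ex y.
  have [f f0 fE] := t_frame x q Pq; have [f' f'0 f'E] := t_frame y q' Pq'.
  (* The scalar matrix [b] multiplies every [u i] by the ratio [f' / f], which compensates the
     difference between the two points. *)
  have [b b0 bE] := positive_scaling rs (divr_gt0 f'0 f0).
  exists (scaled_frame_iso q q' b0); rewrite /t /= fE f'E -push_frameZ.
  rewrite tensor_map_scaled_frame_iso rho_scalar // bE -push_frameZ.
  by rewrite scalerA divfK ?gt_eqF.
have comp x (q q' : frame x) g : P x q -> g \in unitmx -> frame_act q' g q ->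
    exists2 f, 0 < f & forall i, push (iso_inv q') q' (t i x) = f *: rho g (u i).
  move=> Pq gu qq'; have [f f0 fE] := t_frame x q Pq; exists f => // i.
  by rewrite /t /= fE (push_frame_act _ gu qq') componentsZ push_frameK.
exists (fun i => u (enum_val i)); split.
- by exists (enum_rank i0); rewrite enum_rankK.
- apply/seteqP; split=> [g Ng|g [gu [c c0 uc]]].
    split; first exact: Nunit.
    by have [c c0 uc] := uN g Ng; exists c => //; rewrite gt_eqF.
  by apply: (Nu g c gu c0) => i; rewrite -[i]enum_rankK; exact: uc.
- move=> x; exists (enum_rank i0) => ti0; have [q Pq] := P_ex x.
  have [|f f0 fE] := comp x q q 1%:M Pq (unitmx1 _ _); first by move=> w; rewrite mul1mx.
  have : f *: rho 1%:M (u i0) = 0 by rewrite -fE -[i0]enum_rankK [t _ _]ti0; exact: tensor_eqP.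
  by rewrite rho1 => /eqP; rewrite scaler_eq0 gt_eqF //= => /eqP; exact: ui0.
- move=> x q; have [q' Pq'] := P_ex x; have [g gu qq'] := frame_change q q'.
  have [f f0 fE] := comp x q' q g Pq' gu qq'.
  by exists g, f; split=> //; [rewrite gt_eqF | move=> i; exact: fE].
- move=> x q; split=> [Pq|[c c0 tc]].
    have [|f f0 fE] := comp x q q 1%:M Pq (unitmx1 _ _); first by move=> w; rewrite mul1mx.
    exists f => [|i]; first by rewrite gt_eqF.
    by rewrite [LHS]fE rho1.
  have [q' Pq'] := P_ex x; have [g gu q'q] := frame_change q q'.
  have [f f0 fE] := comp x q' q g Pq' gu q'q.
  (* As [q'] is [q] acted upon by [g], the components in [q] are [f] times [rho g u]; comparison
     with [c] times [u] shows that [g] preserves the line of [u]. *)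
  have Ng : normalizer G g.
    have f0' : f != 0 by rewrite gt_eqF.
    apply: (Nu g (f^-1 * c) gu); first by rewrite mulf_neq0 ?invr_neq0.
    move=> i; have := tc (enum_rank i); rewrite /components /= enum_rankK.
    by rewrite [X in X = _]fE -scalerA => <-; rewrite scalerA mulVf // scale1r.
  apply/(P_act x q' q Pq'); exists (invmx g); first exact: NV.
  exact: frame_act_inv.
Qed.

(** For [n = 0] the volume form has type [(0, 0)] and gives no rescaling; but there is only one
    matrix, so [P] contains all frames and a nonzero scalar field has no condition to detect. *)
Lemma projectivization_dim0 (R : realType) (G : set 'M[R]_0)
    (M : manifold R 0) (P : forall x : M, set (frame x)) :
    subgroup G -> K_structure (normalizer G) P ->
  exists (m : nat) (r s : 'I_m -> nat) (t : forall i : 'I_m, tensor_field M (r i) (s i)),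
    (forall i, zero_deformable (t i)) /\ given_by_projectivization (normalizer G) P t.
Proof.
move=> sG [P_act P_local].
pose one (V : lmodType R) : tensor V 0 0 :=
  simple_tensor (fun i : 'I_0 => 0) (fun i : 'I_0 => \0 : {linear V -> R^o}).
have oneE (V : lmodType R) alpha v : one V alpha v = 1.
  by rewrite /= /simple_tensor_val !big_ord0 mulr1.
have push_one (U V : lmodType R) (f : {linear U -> V}) f' : push f f' (one U) = one V.
  by apply: tensor_eqP => alpha v; rewrite oneE; exact: oneE.
have one_neq0 (V : lmodType R) : one V <> 0.
  move=> o0; have := oneE V (fun i : 'I_0 => \0 : {linear V -> R^o}) (fun i : 'I_0 => 0).
  by rewrite o0 => /esym/eqP; rewrite oner_eq0.
have one_smooth i (b : 'I_0 -> 'I_0) (d : 'I_0 -> 'I_0) :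
    smooth_on (V := R^o) (chart_dom i) (fun x : M => one (tangent x)
      (fun k => dcoord i (b k) : {linear tangent x -> R^o}) (fun k => dchart i x (d k))).
  have oi := @chart_dom_open _ _ M i.
  by apply: (smooth_on_eq oi _ (smooth_on_cst oi 1)) => x _; rewrite oneE.
have N1 : normalizer G = [set g | g \in unitmx].
  apply/seteqP; split=> [g []//|g gu]; split=> //.
  apply/seteqP; split=> [_ [h Gh <-]|h Gh]; first by rewrite [_ *m g]flatmx0 -[0](flatmx0 h).
  by exists h; rewrite // [_ *m g]flatmx0 [RHS]flatmx0.
have P_ex x : exists q, P x q.
  by have [U [q [_ Ux _ Pq]]] := P_local x; exists (q x); exact: Pq.
have P_all x q : P x q.
  have [q' Pq'] := P_ex x; apply/(P_act x q' q Pq').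
  by have [g gu qq'] := frame_change q' q; exists g; rewrite ?N1.
exists 1%N, (fun=> 0%N), (fun=> 0%N), (fun=> TensorField one_smooth); split.
  move=> _ x y; have [q _] := P_ex x; have [q' _] := P_ex y.
  by exists (scaled_frame_iso q q' (oner_neq0 R)); exact: push_one.
exists (fun=> one 'cV[R]_0); split.
- by exists 0; exact: one_neq0.
- rewrite N1; apply/seteqP; split=> [g gu|g []//]; split=> //.
  by exists 1; rewrite ?oner_neq0 // => _; rewrite scale1r; exact: push_one.
- by move=> x; exists 0; exact: one_neq0.
- move=> x q; exists 1%:M, 1; split; [exact: unitmx1|exact: oner_neq0|].
  by move=> i; rewrite scale1r rho1; exact: push_one.
- move=> x q; split=> [_|_]; last exact: P_all.
  exists 1 => [|i]; first exact: oner_neq0.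
  by rewrite scale1r; exact: push_one.
Qed.

Theorem theorem7p5 (R : realType) (n : nat) (G : set 'M[R]_n)
    (hG : algebraic_subgroup G) (M : manifold R n)
    (P : forall x : M, set (frame x)) (hP : K_structure (normalizer G) P) :
  exists (m : nat) (r s : 'I_m -> nat)
         (t : forall i : 'I_m, tensor_field M (r i) (s i)),
    (forall i, zero_deformable (t i)) /\
    given_by_projectivization (normalizer G) P t.
Proof.
case: n => [|n] in G hG M P hP *; first by apply: projectivization_dim0 hP; case: hG.
exact: projectivization_dim_gt0.
Qed.
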